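(* Let $\mathfrak s$ be a $6$-dimensional non-nilpotent real Lie algebra with an abelian complex structure $J$ such that $\mathfrak s'_J\cong\mathbb R^4$ (the $4$-dimensional abelian Lie algebra). Then $(\mathfrak s,J)$ is holomorphically isomorphic to one and only one of the following, where each Lie algebra has basis $f_1,f_2,e_1,e_2,e_3,e_4$: \begin{enumerate} \item $(\mathfrak{aff}(\mathbb C)\times\mathbb R^2,J)$: $[f_1,e_1]=[f_2,e_2]=e_1$, $[f_1,e_2]=-[f_2,e_1]=e_2$; $Jf_1=f_2$, $Je_1=e_2-e_3$, $Je_2=-e_1-e_4$, $Je_3=-e_4$; \item $(\mathfrak s_1,J_1)$: $[f_1,f_2]=e_3$, $[f_1,e_1]=[f_2,e_2]=e_1$, $[f_1,e_2]=-[f_2,e_1]=e_2$; $J_1f_1=f_2$, $J_1e_1=e_2-e_3$, $J_1e_2=-e_1-e_4$, $J_1e_3=-e_4$; \item $(\mathfrak s_1,J_2)$: $[f_1,f_2]=e_3$, $[f_1,e_1]=[f_2,e_2]=e_1$, $[f_1,e_2]=-[f_2,e_1]=e_2$; $J_2f_1=f_2$, $J_2e_1=e_2$, $J_2e_3=e_4$; \item $(\mathfrak s_2,J)$: $[f_1,e_1]=[f_2,e_2]=e_1$, $[f_1,e_2]=-[f_2,e_1]=e_2$, $[f_1,e_3]=[f_2,e_4]=e_1+e_3$, $[f_1,e_4]=-[f_2,e_3]=e_2+e_4$; $Jf_1=f_2$, $Je_1=e_2$, $Je_3=e_4$; \item $(\mathfrak s_{(a,b)},J)$, $(a,b)\in\mathcal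 R$: $[f_1,e_1]=[f_2,e_2]=e_1$, $[f_1,e_2]=-[f_2,e_1]=e_2$, $[f_1,e_3]=[f_2,e_4]=a\,e_3+b\,e_4$, $[f_1,e_4]=-[f_2,e_3]=-b\,e_3+a\,e_4$; $Jf_1=f_2$, $Je_1=e_2$, $Je_3=e_4$, \end{enumerate} where $$\mathcal R=\{(a,b)\in\mathbb R^2: 0<a^2+b^2<1\}\cup\{(a,b)\in\mathbb R^2: a^2+b^2=1,\ b\ge 0\}.$$
   Context: An abelian complex structure on a real Lie algebra $\mathfrak g$ is a linear endomorphism $J$ with $J^2=-I$ and $[Jx,Jy]=[x,y]$ for all $x,y\in\mathfrak g$. Write $\mathfrak s'=[\mathfrak s,\mathfrak s]$ and $\mathfrak s'_J=\mathfrak s'+J\mathfrak s'$. Two pairs $(\mathfrak g_1,J_1)$, $(\mathfrak g_2,J_2)$ are holomorphically isomorphic if there is a Lie algebra isomorphism $\alpha:\mathfrak g_1\to\mathfrak g_2$ with $J_2\alpha=\alpha J_1$. Only nonzero brackets are listed (up to skew-symmetry), and values of the complex structures on unlisted basis vectors are determined by $J^2=-I$. $\mathfrak{aff}(\mathbb C)$ is the realification of the Lie algebra of the group of affine motions of $\mathbb C$. *)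

(* Defs.v *)
From HB Require Import structures.
From mathcomp Require Import all_boot all_order all_algebra.
From mathcomp Require Import reals complex ring.

Set Implicit Arguments.
Unset Strict Implicit.
Unset Printing Implicit Defensive.

Import Order.TTheory GRing.Theory Num.Theory.
Local Open Scope ring_scope.

Definition jacobi_identity (V : zmodType) (br : V -> V -> V) :=
  forall x y z, br x (br y z) + br y (br z x) + br z (br x y) = 0.

HB.mixin Record Vector_isLieAlgebra (K : fieldType) V of Vector K V := {
  bracket : V -> V -> V;
  bracket_linearl : forall y, linear (bracket^~ y);
  bracket_linearr : forall x, linear (bracket x);
  bracketxx : forall x, bracket x x = 0;
  bracket_jacobi : jacobi_identity bracket
}.

#[short(type="lieAlgType")]
HB.structure Definition LieAlgebra (K : fieldType) :=
  { V of Vector_isLieAlgebra K V & Vector K V }.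

Notation "[ 'lie' x , y ]" := (bracket x y)
  (at level 0, x, y at level 99, format "[ 'lie'  x ,  y ]") : ring_scope.

Section LieTheory.
Variable K : fieldType.
Implicit Types g h : lieAlgType K.

Definition lie_prod g (U V : {vspace g}) : {vspace g} :=
  <<[seq [lie u, v] | u <- vbasis U, v <- vbasis V]>>%VS.

(* lie_prod U V is the span of all brackets, not only of those of the chosen
   bases. *)
Lemma lie_prodP g (U V W : {vspace g}) :
  reflect (forall u v, u \in U -> v \in V -> [lie u, v] \in W)
          (lie_prod U V <= W)%VS.
Proof.
apply: (iffP idP) => [sUVW u v Uu Vv | sUVW].
  apply: (subvP sUVW).
  have lin0 (f : g -> g) : linear f -> f 0 = 0.
    by move=> lf; have := lf (-1) 0 0; rewrite scaler0 addr0 scaleN1r addNr.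
  have linS (f : g -> g) m (a : 'I_m -> K) (b : 'I_m -> g) (X : {vspace g}) :
      linear f ->
      (forall i, f (b i) \in X) -> f (\sum_i a i *: b i) \in X.
    move=> lf fX; elim/big_rec: _ => [|i x _ xX]; first by rewrite lin0 ?mem0v.
    by rewrite lf memvD // memvZ.
  rewrite (coord_vbasis Uu).
  apply: (linS _ _ _ _ _ (bracket_linearl v)) => i.
  rewrite (coord_vbasis Vv).
  apply: (linS _ _ _ _ _ (bracket_linearr (vbasis U)`_i)) => j.
  apply: memv_span.
  by apply: allpairs_f; rewrite mem_nth // size_tuple.
apply/span_subvP=> _ /allpairsP[[u v] /= [Uu Vv ->]].
by apply: sUVW; apply: vbasis_mem.
Qed.

Definition derived_algebra g : {vspace g} := lie_prod fullv fullv.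

Fixpoint lower_central_series g n : {vspace g} :=
  if n is m.+1 then lie_prod fullv (lower_central_series g m) else fullv.

Definition nilpotent g := exists n, lower_central_series g n = 0%VS.

Definition lie_morphism g h (alpha : 'Hom(g, h)) :=
  forall x y, alpha [lie x, y] = [lie alpha x, alpha y].

Definition abelian_complex_structure g (J : 'End(g)) :=
  (forall x, J (J x) = - x) /\ (forall x y, [lie J x, J y] = [lie x, y]).

Definition derived_J g (J : 'End(g)) : {vspace g} :=
  (derived_algebra g + J @: derived_algebra g)%VS.

(* The subspace U of g, with the brackets of g, is a Lie algebra isomorphic
   to h. *)
Definition subspace_lie_isomorphic g (U : {vspace g}) h :=
  exists alpha : 'Hom(h, g),
    [/\ lker alpha = 0%VS, limg alpha = U & lie_morphism alpha].

Definition holomorphically_isomorphic g1 (J1 : 'End(g1)) g2 (J2 : 'End(g2)) :=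
  exists alpha : 'Hom(g1, g2),
    [/\ bijective alpha, lie_morphism alpha
      & forall x, J2 (alpha x) = alpha (J1 x)].

End LieTheory.

Section TableLie.
Variables (K : fieldType) (n : nat).

(* For i < j, c i j is the bracket of the i-th and j-th vectors of the standard
   basis of K^n; the values for i >= j are ignored. *)
Definition table_bracket (c : nat -> nat -> 'rV[K]_n) (x y : 'rV[K]_n) :=
  \sum_(i < n) \sum_(j < n | (i < j)%N)
    (x 0 i * y 0 j - x 0 j * y 0 i) *: c i j.

Definition table_lie c of jacobi_identity (table_bracket c) : Type := 'rV[K]_n.

Lemma table_bracket_linearr c x : linear (table_bracket c x).
Proof.
move=> a y z; rewrite /table_bracket scaler_sumr -big_split; apply: eq_bigr=> i _.
rewrite scaler_sumr -big_split; apply: eq_bigr => j _ /=.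
by rewrite scalerA -scalerDl !mxE; congr (_ *: _); ring.
Qed.

Lemma table_bracket_linearl c y : linear (table_bracket c ^~ y).
Proof.
move=> a x z; rewrite /table_bracket scaler_sumr -big_split; apply: eq_bigr=> i _.
rewrite scaler_sumr -big_split; apply: eq_bigr => j _ /=.
by rewrite scalerA -scalerDl !mxE; congr (_ *: _); ring.
Qed.

Lemma table_bracketxx c x : table_bracket c x x = 0.
Proof.
rewrite /table_bracket big1 // => i _; rewrite big1 // => j _.
by rewrite [x 0 i * _]mulrC subrr scale0r.
Qed.

HB.instance Definition _ c (jac : jacobi_identity (table_bracket c)) :=
  Vector.copy (table_lie jac) 'rV[K]_n.
HB.instance Definition _ c (jac : jacobi_identity (table_bracket c)) :=
  Vector_isLieAlgebra.Build K (table_lie jac) (@table_bracket_linearl c)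
    (@table_bracket_linearr c) (@table_bracketxx c) jac.

Lemma abelian_jacobi : jacobi_identity (table_bracket (fun _ _ => 0)).
Proof.
have br0 x y : table_bracket (fun _ _ => 0) x y = 0.
  by rewrite /table_bracket big1 // => i _; rewrite big1 // => j _; rewrite scaler0.
by move=> x y z; rewrite !br0 !addr0.
Qed.

Definition abelian_lie : lieAlgType K := table_lie abelian_jacobi.

(* The endomorphism mapping the i-th vector of the standard basis to t i. *)
Definition table_end (t : nat -> 'rV[K]_n) : 'End('rV[K]_n) :=
  linfun (mulmxr (\matrix_(i < n) t i)).

End TableLie.

Section Models.
Variable R : realType.

(* The indices 0, ..., 5 stand for f1, f2, e1, e2, e3, e4. *)
Definition base (k : nat) : 'rV[R]_6 := \row_(j < 6) (j == k :> nat)%:R.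
Local Notation f1 := (base 0).
Local Notation f2 := (base 1).
Local Notation e1 := (base 2).
Local Notation e2 := (base 3).
Local Notation e3 := (base 4).
Local Notation e4 := (base 5).

Definition affC_R2_table i j :=
  match i, j with
  | 0, 2 => e1 | 1, 3 => e1
  | 0, 3 => e2 | 1, 2 => - e2
  | _, _ => 0
  end.

Definition s1_table i j :=
  match i, j with
  | 0, 1 => e3
  | 0, 2 => e1 | 1, 3 => e1
  | 0, 3 => e2 | 1, 2 => - e2
  | _, _ => 0
  end.

Definition s2_table i j :=
  match i, j with
  | 0, 2 => e1 | 1, 3 => e1
  | 0, 3 => e2 | 1, 2 => - e2
  | 0, 4 => e1 + e3 | 1, 5 => e1 + e3
  | 0, 5 => e2 + e4 | 1, 4 => - (e2 + e4)
  | _, _ => 0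
  end.

Definition sab_table (a b : R) i j :=
  match i, j with
  | 0, 2 => e1 | 1, 3 => e1
  | 0, 3 => e2 | 1, 2 => - e2
  | 0, 4 => a *: e3 + b *: e4 | 1, 5 => a *: e3 + b *: e4
  | 0, 5 => - b *: e3 + a *: e4 | 1, 4 => - (- b *: e3 + a *: e4)
  | _, _ => 0
  end.

Definition J_std_table i :=
  match i with
  | 0 => f2 | 1 => - f1
  | 2 => e2 | 3 => - e1
  | 4 => e4 | 5 => - e3
  | _ => 0
  end.

Definition J_twisted_table i :=
  match i with
  | 0 => f2 | 1 => - f1
  | 2 => e2 - e3 | 3 => - e1 - e4
  | 4 => - e4 | 5 => e3
  | _ => 0
  end.

Local Definition co (x : 'rV[R]_6) k : R := x 0 (inord k).

Local Lemma row6P (u v : 'rV[R]_6) :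
  (forall k, (k < 6)%N -> co u k = co v k) -> u = v.
Proof. by move=> uv; apply/rowP => j; rewrite -(inord_val j); apply: uv. Qed.

Local Lemma co_base i k : (k < 6)%N -> co (base i) k = (k == i)%:R.
Proof. by move=> k6; rewrite /co mxE inordK. Qed.

Local Lemma coD x y k : co (x + y) k = co x k + co y k.
Proof. by rewrite /co mxE. Qed.
Local Lemma coN x k : co (- x) k = - co x k.
Proof. by rewrite /co mxE. Qed.
Local Lemma coZ a x k : co (a *: x) k = a * co x k.
Proof. by rewrite /co mxE. Qed.
Local Lemma co0 k : co 0 k = 0.
Proof. by rewrite /co mxE. Qed.

Local Lemma table_bracketE c (x y : 'rV[R]_6) :
  let p i j := (co x i * co y j - co x j * co y i) *: c i j in
  table_bracket c x y =
    p 0 1 + p 0 2 + p 0 3 + p 0 4 + p 0 5 + p 1 2 + p 1 3 + p 1 4 + p 1 5 +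
    p 2 3 + p 2 4 + p 2 5 + p 3 4 + p 3 5 + p 4 5.
Proof.
move=> p.
have -> : table_bracket c x y =
    \sum_(0 <= i < 6) \sum_(0 <= j < 6) (if (i < j)%N then p i j else 0).
  rewrite /table_bracket big_mkord; apply: eq_bigr => i _.
  rewrite big_mkord big_mkcond; apply: eq_bigr => j _.
  by rewrite /p /co !inord_val.
by rewrite !unlock /= !(add0r, addr0) !addrA.
Qed.

Local Ltac coords := rewrite ?(coD, coN, coZ, co0) ?co_base //=.

(* Common coordinate form of the four brackets. *)
Local Definition gen_bracket (w p a b : R) x y k : R :=
  let m i j := co x i * co y j - co x j * co y i in
  match k with
  | 2 => m 0 2 + m 1 3 + p * (m 0 4 + m 1 5)
  | 3 => m 0 3 - m 1 2 + p * (m 0 5 - m 1 4)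
  | 4 => w * m 0 1 + a * (m 0 4 + m 1 5) - b * (m 0 5 - m 1 4)
  | 5 => b * (m 0 4 + m 1 5) + a * (m 0 5 - m 1 4)
  | _ => 0
  end.

Local Definition gen_table w p a b c := forall x y k, (k < 6)%N ->
  co (table_bracket c x y) k = gen_bracket w p a b x y k.

Local Ltac table_tac k k6 := rewrite table_bracketE /=; coords;
  rewrite /gen_bracket; case: k k6 => [|[|[|[|[|[|k]]]]]] //= _; ring.

Local Lemma affC_R2_gen : gen_table 0 0 0 0 affC_R2_table.
Proof. by move=> x y k k6; table_tac k k6. Qed.
Local Lemma s1_gen : gen_table 1 0 0 0 s1_table.
Proof. by move=> x y k k6; table_tac k k6. Qed.
Local Lemma s2_gen : gen_table 0 1 1 0 s2_table.
Proof. by move=> x y k k6; table_tac k k6. Qed.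
Local Lemma sab_gen a b : gen_table 0 0 a b (sab_table a b).
Proof. by move=> x y k k6; table_tac k k6. Qed.

Local Lemma gen_jacobi w p a b c : w * p = 0 -> w * a = 0 -> w * b = 0 ->
  gen_table w p a b c -> jacobi_identity (table_bracket c).
Proof.
move=> wp wa wb cE x y z; apply: row6P => k k6; coords; rewrite !cE //.
rewrite /gen_bracket !cE // /gen_bracket.
case: k k6 => [|[|[|[|[|[|k]]]]]] //= _; ring: wp wa wb.
Qed.

Lemma affC_R2_jacobi : jacobi_identity (table_bracket affC_R2_table).
Proof. by apply: (gen_jacobi _ _ _ affC_R2_gen); rewrite mul0r. Qed.
Lemma s1_jacobi : jacobi_identity (table_bracket s1_table).
Proof. by apply: (gen_jacobi _ _ _ s1_gen); rewrite mulr0. Qed.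
Lemma s2_jacobi : jacobi_identity (table_bracket s2_table).
Proof. by apply: (gen_jacobi _ _ _ s2_gen); rewrite mul0r. Qed.
Lemma sab_jacobi a b : jacobi_identity (table_bracket (sab_table a b)).
Proof. by apply: (gen_jacobi _ _ _ (@sab_gen a b)); rewrite mul0r. Qed.

Definition affC_R2 : lieAlgType R := table_lie affC_R2_jacobi.
Definition s1 : lieAlgType R := table_lie s1_jacobi.
Definition s2 : lieAlgType R := table_lie s2_jacobi.
Definition sab a b : lieAlgType R := table_lie (@sab_jacobi a b).

(* The Lie algebra of the group of maps t |-> z t + w consists of the matrices
   with rows (z, w) and (0, 0), here written as pairs. *)
Definition affC_bracket (u v : R[i] * R[i]) : R[i] * R[i] :=
  (0, u.1 * v.2 - v.1 * u.2).

(* f1, f2, e1, e2 correspond to (1, 0), (-i, 0), (0, 1), (0, i), and e3, e4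
   span the factor R^2. *)
Lemma affC_R2_product (x y : affC_R2) :
  let phi (v : 'rV[R]_6) : R[i] * R[i] :=
    (Complex (v 0 (inord 0)) (- v 0 (inord 1)),
     Complex (v 0 (inord 2)) (v 0 (inord 3))) in
  let xy : 'rV[R]_6 := [lie x, y] in
  [/\ phi xy = affC_bracket (phi x) (phi y),
      xy 0 (inord 4) = 0 & xy 0 (inord 5) = 0].
Proof.
move=> phi xy.
have xyE k (k6 : (k < 6)%N) : xy 0 (inord k) = _ := affC_R2_gen x y k6.
rewrite /phi !xyE // /gen_bracket /co; split; try ring.
rewrite /affC_bracket /=; congr pair; first by congr Complex; ring.
by apply/eqP; rewrite eq_complex /=; apply/andP; split; apply/eqP; ring.
Qed.

Definition regionR (p : R * R) : bool :=
  let: (a, b) := p in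
  (0 < a ^+ 2 + b ^+ 2 < 1) || ((a ^+ 2 + b ^+ 2 == 1) && (0 <= b)).

Inductive model : Type :=
  | AffC_R2_J | S1_J1 | S1_J2 | S2_J | Sab_J of {p : R * R | regionR p}.

Definition model_lie (m : model) : lieAlgType R :=
  match m with
  | AffC_R2_J => affC_R2
  | S1_J1 | S1_J2 => s1
  | S2_J => s2
  | Sab_J p => sab (val p).1 (val p).2
  end.

Definition model_J (m : model) : 'End(model_lie m) :=
  match m with
  | AffC_R2_J | S1_J1 => table_end J_twisted_table
  | S1_J2 | S2_J | Sab_J _ => table_end J_std_table
  end.

Local Lemma co_table_end t (x : 'rV[R]_6) k : co (table_end t x) k =
  co x 0 * co (t 0) k + co x 1 * co (t 1) k + co x 2 * co (t 2) k +
  co x 3 * co (t 3) k + co x 4 * co (t 4) k + co x 5 * co (t 5) k.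
Proof.
have -> : co (table_end t x) k = \sum_(0 <= i < 6) co x i * co (t i) k.
  rewrite /table_end lfunE /= /co mxE big_mkord; apply: eq_bigr => i _.
  by rewrite mxE inord_val.
by rewrite unlock /= addr0 !addrA.
Qed.

Lemma model_abelian_complex_structure m :
  abelian_complex_structure (model_J m).
Proof.
have std_sqr (x : 'rV[R]_6) :
    table_end J_std_table (table_end J_std_table x) = - x.
  apply: row6P => k k6; rewrite !co_table_end /=; coords.
  by case: k k6 => [|[|[|[|[|[|k]]]]]] //= _; ring.
have twisted_sqr (x : 'rV[R]_6) :
    table_end J_twisted_table (table_end J_twisted_table x) = - x.
  apply: row6P => k k6; rewrite !co_table_end /=; coords.
  by case: k k6 => [|[|[|[|[|[|k]]]]]] //= _; ring.
have std_ab w p a b c (x y : 'rV[R]_6) : gen_table w p a b c ->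
    table_bracket c (table_end J_std_table x) (table_end J_std_table y)
    = table_bracket c x y.
  move=> cE; apply: row6P => k k6; rewrite !cE // /gen_bracket !co_table_end /=.
  coords; case: k k6 => [|[|[|[|[|[|k]]]]]] //= _; ring.
have twisted_ab w c (x y : 'rV[R]_6) : gen_table w 0 0 0 c ->
    table_bracket c (table_end J_twisted_table x) (table_end J_twisted_table y)
    = table_bracket c x y.
  move=> cE; apply: row6P => k k6; rewrite !cE // /gen_bracket !co_table_end /=.
  coords; case: k k6 => [|[|[|[|[|[|k]]]]]] //= _; ring.
case: m => [||||p]; split => x //; try exact: std_sqr; try exact: twisted_sqr.
- by move=> y; apply: twisted_ab affC_R2_gen.
- by move=> y; apply: twisted_ab s1_gen.
- by move=> y; apply: std_ab s1_gen.
- by move=> y; apply: std_ab s2_gen.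
- by move=> y; apply: std_ab (@sab_gen _ _).
Qed.

End Models.

(* Main.v *)
Require Import Defs.
From HB Require Import structures.
From mathcomp Require Import all_boot all_order all_algebra.
From mathcomp Require Import reals complex ring.

(* Let u = s' + J s', and choose f outside u, so that s = C f + u with u
   abelian.  As [J v, w] = - [v, J w], the bracket is determined by the real
   endomorphism A = ad f of u and by w = [f, J f]; replacing f by z f + v
   multiplies A by a nonzero complex number and changes w by an element of the
   image of A and a positive factor.  The Jacobi identity says that A kills the
   image of the antilinear map D = A J - J A.  If D = 0, then A is a complex 2x2
   matrix up to conjugation and scaling, and the ratio of its eigenvalues is
   defined up to inversion.  If D <> 0, then D^2 = 0 and A, not being nilpotent,
   has one normal form, with w either removable or normalized to D x, where x
   satisfies A x = x.  Uniqueness: D, w modulo the image of A and, when D = 0,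
   trace^2 / det are invariants. *)

Set Implicit Arguments.
Unset Strict Implicit.
Unset Printing Implicit Defensive.

Import Order.TTheory GRing.Theory Num.Theory.
Local Open Scope ring_scope.

(** * Comparison of coefficients in linear combinations *)

Section ComplexForm.
Variables (C : numClosedFieldType) (V : lmodType C).
Implicit Types (a b c k : C) (f x y v w : V).

(* Replacing four vectors by the values of [phi] turns an identity between their
   linear combinations into identities between coefficients. *)
Lemma lincombP f x y w : exists phi : C -> C -> C -> C -> V,
  [/\ phi 1 0 0 0 = f, phi 0 1 0 0 = x, phi 0 0 1 0 = y, phi 0 0 0 1 = w
    & phi 0 0 0 0 = 0] /\
  [/\ forall a b c d a' b' c' d',
        phi a b c d + phi a' b' c' d' = phi (a + a') (b + b') (c + c') (d + d'),
      forall a b c d, - phi a b c d = phi (- a) (- b) (- c) (- d)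
    & forall k a b c d, k *: phi a b c d = phi (k * a) (k * b) (k * c) (k * d)].
Proof.
exists (fun a b c d => a *: f + b *: x + c *: y + d *: w).
do 2!split; rewrite ?scale1r ?scale0r ?add0r ?addr0 //.
- move=> a b c d a' b' c' d'; rewrite !scalerDl addrACA; congr (_ + _).
  by rewrite addrACA; congr (_ + _); rewrite addrACA.
- by move=> *; rewrite !scaleNr -!opprD.
- by move=> *; rewrite !scalerDr !scalerA.
Qed.

End ComplexForm.

(** Fewer than four vectors are handled by repeating one: the first copy absorbs every occurrence in
    the goal, and [try] skips the later rewrites that then fail. After [congr phi] only scalar goals
    remain. *)
Ltac lincomb_with f x y w :=
  let phi := fresh "phi" in
  let Z0 := fresh in let D := fresh in let N := fresh in let S := fresh in
  let F := fresh in let X := fresh in let Y := fresh in let W := fresh in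
  case: (lincombP f x y w) => phi [[F X Y W Z0] [D N S]];
  rewrite ?(scaler0, addr0, add0r, oppr0, subr0, sub0r);
  try (rewrite -F); try (rewrite -X); try (rewrite -Y); try (rewrite -W);
  rewrite ?(N, S, D); rewrite -?[RHS]Z0; congr phi.
Ltac lincomb f x y w := lincomb_with f x y w; ring.

(** * Complex frames adapted to an abelian ideal *)

Section Frames.
Variables (C : numClosedFieldType) (V : lmodType C) (br : V -> V -> V).
Implicit Types (a b c d k l m p q r s z : C) (f x y u v w : V).

(* [V] is the Lie algebra with ['i] acting as the complex structure, so the
   bracket is only real bilinear. *)
Record acs_bracket : Prop := AcsBracket {
  acsDr : forall x, {morph br x : y w / y + w};
  acsZr : forall x r y, r \is Num.real -> br x (r *: y) = r *: br x y;
  acsxx : forall x, br x x = 0;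
  acs_skew : forall x y, br x y = - br y x;
  acsi : forall x y, br ('i *: x) ('i *: y) = br x y;
  acs_jacobi : jacobi_identity br
}.

Definition plane x y v := exists a b, v = a *: x + b *: y.

(** A complex basis of [V] whose last two vectors span an abelian ideal containing all brackets.
    Being stable under ['i], this ideal contains s' + J s'. *)
Record frame f x y : Prop := Frame {
  frame_span : forall v, exists a b c, v = a *: f + b *: x + c *: y;
  frame_free : forall a b c, a *: f + b *: x + c *: y = 0 ->
    [/\ a = 0, b = 0 & c = 0];
  frame_br : forall v w, plane x y (br v w);
  frame_abelian : forall v w, plane x y v -> plane x y w -> br v w = 0
}.

Hypothesis Hbr : acs_bracket.

Lemma planeD x y u v : plane x y u -> plane x y v -> plane x y (u + v).
Proof.
move=> [a [b ->]] [c [d ->]]; exists (a + c), (b + d).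
lincomb x y x y.
Qed.

Lemma planeZ x y k v : plane x y v -> plane x y (k *: v).
Proof.
by move=> [a [b ->]]; exists (k * a), (k * b); lincomb x y x y.
Qed.

Lemma planel x y : plane x y x.
Proof. by exists 1, 0; lincomb x y x y. Qed.

Lemma planer x y : plane x y y.
Proof. by exists 0, 1; lincomb x y x y. Qed.

Lemma acsDl x y w : br (x + y) w = br x w + br y w.
Proof. by rewrite !(acs_skew Hbr _ w) (acsDr Hbr) opprD. Qed.

Lemma acsN x y : br x (- y) = - br x y.
Proof. by rewrite -!scaleN1r (acsZr Hbr) // rpredN real1. Qed.

Lemma acsZ_rect x z y :
  br x (z *: y) = 'Re z *: br x y + 'Im z *: br x ('i *: y).
Proof.
rewrite {1}[z]Crect scalerDl (acsDr Hbr) [_ * 'Im z]mulrC -scalerA.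
by rewrite !(acsZr Hbr _ _ (Creal_Re z), acsZr Hbr _ _ (Creal_Im z)).
Qed.

Lemma acs_il x y : br ('i *: x) y = - br x ('i *: y).
Proof.
have {1}->: y = - ('i *: ('i *: y)).
  by rewrite scalerA -expr2 sqrCi scaleN1r opprK.
by rewrite acsN (acsi Hbr).
Qed.

(** Real scalars pass from one argument to the other, and ['i] does so with a change of sign. Hence
    ad of [z *: f] is ad [f] after multiplication by [z^*], which is why [f] is later rescaled by
    conjugates. *)
Lemma acsZl z x y : br (z *: x) y = br x (z^* *: y).
Proof.
have e : br y ('i *: x) = br x ('i *: y).
  by rewrite (acs_skew Hbr) acs_il opprK.
rewrite (acs_skew Hbr) acsZ_rect [RHS]acsZ_rect Re_conj Im_conj e.
rewrite (acs_skew Hbr y x).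
by lincomb (br x y) (br x ('i *: y)) (br x y) (br x y).
Qed.

(** * Changes of frame and the action of [f] on the plane *)

Section Change.
Variables (f x y : V).
Hypothesis F : frame f x y.

Lemma frame_shift u : plane x y u -> frame (f + u) x y.
Proof.
move=> [k [l ->]]; split; last exact: frame_abelian F.
- move=> v; have [a [b [c ->]]] := frame_span F v.
  by exists a, (b - a * k), (c - a * l); lincomb f x y x.
- move=> a b c e.
  have [|a0 b0 c0] := frame_free F (a := a) (b := b + a * k) (c := c + a * l).
    by rewrite -[RHS]e; lincomb f x y x.
  by move: b0 c0; rewrite a0 !mul0r !addr0.
- exact: frame_br F.
Qed.

Lemma frame_scale z : z != 0 -> frame (z *: f) x y.
Proof.
move=> z0; split; last exact: frame_abelian F.
- move=> v; have [a [b [c ->]]] := frame_span F v.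
  by exists (a / z), b, c; rewrite scalerA divfK.
- move=> a b c; rewrite scalerA => /(frame_free F)[/eqP].
  by rewrite mulf_eq0 (negPf z0) orbF => /eqP-> -> ->.
- exact: frame_br F.
Qed.

Lemma plane_sub a b c d v :
  plane (a *: x + b *: y) (c *: x + d *: y) v -> plane x y v.
Proof.
move=> [k [l ->]]; exists (k * a + l * c), (k * b + l * d).
by lincomb x y x y.
Qed.

Lemma frame_plane a b c d : a * d - b * c != 0 ->
  frame f (a *: x + b *: y) (c *: x + d *: y).
Proof.
move=> det0.
have pl v : plane x y v -> plane (a *: x + b *: y) (c *: x + d *: y) v.
  move=> [k [l ->]].
  (* Cramer's rule. *)
  exists ((k * d - l * c) / (a * d - b * c)), ((l * a - k * b) / (a * d - b * c)).
  by lincomb_with x y x y; field.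
split.
- move=> v; have [k [l [m ->]]] := frame_span F v.
  have [|l' [m' e]] := pl (l *: x + m *: y); first by exists l, m.
  by exists k, l', m'; rewrite -addrA e addrA.
- move=> k l m e.
  have [|k0 l0 m0] := frame_free F (a := k) (b := l * a + m * c)
      (c := l * b + m * d).
    by rewrite -[RHS]e; lincomb f x y x.
  (* Eliminating one unknown from [l0] and [m0] leaves the other one times the determinant. *)
  have dl : l * (a * d - b * c) = 0.
    by have: d * (l * a + m * c) - c * (l * b + m * d) = 0;
      [rewrite l0 m0; ring | move<-; ring].
  have dm : m * (a * d - b * c) = 0.
    by have: a * (l * b + m * d) - b * (l * a + m * c) = 0;
      [rewrite l0 m0; ring | move<-; ring].
  move/eqP: dl; move/eqP: dm; rewrite !mulf_eq0 (negPf det0) !orbF.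
  by move=> /eqP-> /eqP->.
- by move=> v w; apply: pl; apply: frame_br F v w.
- by move=> v w /plane_sub pv /plane_sub pw; apply: (frame_abelian F).
Qed.

Lemma frame_planeE x' y' a b c d : x' = a *: x + b *: y -> y' = c *: x + d *: y ->
  a * d - b * c != 0 -> frame f x' y'.
Proof. by move=> -> ->; apply: frame_plane. Qed.

Lemma br_shift u v : plane x y u -> plane x y v -> br (f + u) v = br f v.
Proof. by move=> pu pv; rewrite acsDl (frame_abelian F pu pv) addr0. Qed.

(** The two cross terms agree, because ['i] and skew-symmetry each change the sign once. So a shift
    of [f] moves [br f ('i *: f)] by an arbitrary element of the image of ad [f] on the plane. *)
Lemma br_shift_self u : plane x y u ->
  br (f + u) ('i *: (f + u)) = br f ('i *: f) + 2 *: br f ('i *: u).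
Proof.
move=> pu; rewrite scalerDr !(acsDr Hbr) !acsDl.
rewrite (frame_abelian F pu (planeZ _ pu)) addr0 -addrA; congr (_ + _).
rewrite (acs_skew Hbr u) acs_il opprK.
by rewrite -{1 2}[br f _]scale1r -scalerDl.
Qed.

(** This is the Jacobi identity for [f], ['i *: f], [v]; the term containing [br f ('i *: f)]
    vanishes because the plane is abelian. *)
Lemma ad_ad_i v : plane x y v -> br f ('i *: br f v) = br f (br f ('i *: v)).
Proof.
move=> pv; have := acs_jacobi Hbr f ('i *: f) v.
rewrite (frame_abelian F pv (frame_br F _ _)) addr0 !acs_il acsN.
rewrite (acs_skew Hbr v f) scalerN acsN opprK => /eqP.
by rewrite addrC subr_eq0 => /eqP.
Qed.

Lemma ad_frame v : exists z u, plane x y u /\ v = z *: f + u.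
Proof.
have [a [b [c ->]]] := frame_span F v.
by exists a, (b *: x + c *: y); rewrite addrA; split => //; exists b, c.
Qed.

Lemma br_frame z u v : plane x y u -> plane x y v ->
  br (z *: f + u) v = br f (z^* *: v).
Proof. by move=> pu pv; rewrite acsDl acsZl (frame_abelian F pu pv) addr0. Qed.

Lemma br_frame_frame z z' u u' : plane x y u -> plane x y u' ->
  br (z *: f + u) (z' *: f + u') =
  'Im (z^* * z') *: br f ('i *: f) + br f (z^* *: u') - br f (z'^* *: u).
Proof.
move=> pu pu'; rewrite (acsDr Hbr) (br_frame _ pu pu').
rewrite (acs_skew Hbr _ (z' *: f)) (acsDr Hbr) !acsZl scalerA.
rewrite (acsZ_rect f (z'^* * z)) (acsxx Hbr) scaler0 add0r.
have -> : 'Im (z'^* * z) = - 'Im (z^* * z').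
  by rewrite -Im_conj rmorphM /= conjCK mulrC.
by rewrite scaleNr opprD opprK addrAC.
Qed.

(** The inner bracket lies in the plane, where every ad is ad [f] after a complex scalar. The real
    part of the outer scalar gives a square of ad [f], and [ad_ad_i] turns the imaginary part into
    one as well. *)
Lemma frame_nilpotent : (forall v, plane x y v -> br f (br f v) = 0) ->
  forall v1 v2 v3 v4, br v1 (br v2 (br v3 v4)) = 0.
Proof.
move=> A2 v1 v2 v3 v4.
have pv := frame_br F v3 v4; move: (br v3 v4) pv => v pv.
have [z1 [u1 [p1 ->]]] := ad_frame v1; have [z2 [u2 [p2 ->]]] := ad_frame v2.
rewrite !br_frame //; try exact: frame_br F _ _.
rewrite acsZ_rect A2 ?scaler0 ?add0r; last exact: planeZ.
by rewrite ad_ad_i ?A2 ?scaler0 //; do ?apply: planeZ.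
Qed.

End Change.
End Frames.

(** * Existence of normal frames *)

Section NormalForms.
Variables (C : numClosedFieldType) (V : lmodType C) (br : V -> V -> V).
Implicit Types (a b c d k l m p q r s z : C) (f x y u v w : V).

(** Here [c] measures the failure of ad [f] to be complex linear, [p] and [l] form the second column
    of its matrix, and [d] records the bracket of [f] with J [f]. *)
Record normal_frame c p l d f x y : Prop := NormalFrame {
  nf_frame : frame br f x y;
  nf_x : br f x = x;
  nf_ix : br f ('i *: x) = 'i *: x + c *: y;
  nf_y : br f y = p *: x + l *: y;
  nf_iy : br f ('i *: y) = 'i *: (p *: x + l *: y);
  nf_w : br f ('i *: f) = d *: y
}.

(** The region of the parameters (a, b), read in the complex plane with l = a + ib. *)
Definition normal_ratio l :=
  (0 < `|l| < 1) || (`|l| == 1) && (0 <= 'Im l).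

Inductive admissible : C -> C -> C -> C -> Prop :=
| Adm_affC : admissible 1 0 0 0
| Adm_s1_twisted : admissible 1 0 0 1
| Adm_s1 : admissible 0 0 0 1
| Adm_s2 : admissible 0 1 1 0
| Adm_sab l of normal_ratio l : admissible 0 0 l 0.

(** Inversion exchanges the inside and the outside of the unit circle, and on the circle it is
    conjugation, which flips the sign of the imaginary part. *)
Lemma normal_ratioVr l : l != 0 -> normal_ratio l \/ normal_ratio l^-1.
Proof.
rewrite /normal_ratio normfV => l0; have n0 : 0 < `|l| by rewrite normr_gt0.
rewrite invr_gt0 n0 /=; case: (real_ltgtP (normr_real l) (real1 C)) => [||n1].
- by left.
- by move=> n1; right; rewrite invf_lt1 ?n1.
- rewrite n1 invr1 eqxx /=.
  case: (real_leP (real0 C) (Creal_Im l)) => [|Il]; [by left | right].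
  by rewrite invC_norm n1 expr1n invr1 mul1r Im_conj oppr_ge0 ltW ?orbT.
Qed.

Hypothesis Hbr : acs_bracket br.

Section LinearCase.
Variables (f x y : V).
Hypothesis F : frame br f x y.

(** For [l != 0] the map ad [f] is invertible on the plane, so a shift of [f] makes [br f ('i *: f)]
    vanish. *)
Lemma normal_frame_shift p l : l != 0 -> br f x = x -> br f ('i *: x) = 'i *: x ->
  br f y = p *: x + l *: y -> br f ('i *: y) = 'i *: (p *: x + l *: y) ->
  exists f', normal_frame 0 p l 0 f' x y.
Proof.
move=> l0 Ax Aix Ay Aiy.
have [a [b w]] := frame_br F f ('i *: f).
have lin k v : br f ('i *: v) = 'i *: br f v ->
    br f (k *: v) = k *: br f v.
  by move=> e; rewrite acsZ_rect // e scalerA -scalerDl [in RHS](Crect k)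
    [_ * 'Im k]mulrC.
(* The solution of [2 *: br f v = - br f ('i *: f)]; shifting [f] by [- 'i *: v] then cancels the
   bracket by [br_shift_self]. *)
pose v := (p * b / (2 * l) - a / 2) *: x - (b / (2 * l)) *: y.
have pv : plane x y v.
  by exists (p * b / (2 * l) - a / 2), (- (b / (2 * l))); rewrite scaleNr.
have iNi : 'i *: (- 'i *: v) = v.
  by rewrite scalerA mulrN -expr2 sqrCi opprK scale1r.
have pu := planeZ (- 'i) pv.
exists (f - 'i *: v); rewrite -scaleNr; split; first exact: frame_shift.
- by rewrite (br_shift Hbr F pu (planel x y)).
- rewrite (br_shift Hbr F pu (planeZ _ (planel x y))) Aix.
  by lincomb x y x y.
- by rewrite (br_shift Hbr F pu (planer x y)).
- by rewrite (br_shift Hbr F pu (planeZ _ (planer x y))).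
- rewrite (br_shift_self Hbr F pu) w iNi /v -scaleNr (acsDr Hbr).
  have ix : br f ('i *: x) = 'i *: br f x by rewrite Ax.
  have iy : br f ('i *: y) = 'i *: br f y by rewrite Ay.
  rewrite (lin _ _ ix) (lin _ _ iy) Ax Ay.
  have n2 : 2%:R != 0 :> C by rewrite pnatr_eq0.
  by lincomb_with x y x y; field; rewrite ?n2 ?l0.
Qed.

End LinearCase.

Lemma plane_basis f x y u v : frame br f x y -> plane x y u -> plane x y v ->
  u != 0 -> (forall k, v != k *: u) -> frame br f u v.
Proof.
move=> F [a [b ->]] [c [d ->]] u0 uv; apply: frame_plane => //.
apply/eqP=> /eqP; rewrite subr_eq0 => /eqP adbc.
have [a0|a0] := eqVneq a 0; last first.
  have /eqP[] := uv (c / a).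
  have -> : d = b * c / a by rewrite -adbc mulrAC divff // mul1r.
  by lincomb_with x y x y; field.
have b0 : b != 0 by apply: contraNneq u0 => ->; rewrite a0 !scale0r addr0.
have c0 : c = 0.
  by move/eqP: adbc; rewrite a0 mul0r eq_sym mulf_eq0 (negPf b0) => /eqP.
have /eqP[] := uv (d / b).
by rewrite a0 c0; lincomb_with x y x y; field.
Qed.

Definition ad_linear f x y :=
  forall v, plane x y v -> br f ('i *: v) = 'i *: br f v.

Lemma ad_linearZ f x y : ad_linear f x y ->
  forall k v, plane x y v -> br f (k *: v) = k *: br f v.
Proof.
move=> L k v pv; rewrite acsZ_rect // L // scalerA -scalerDl.
by rewrite [in RHS](Crect k) [_ * 'Im k]mulrC.
Qed.

Lemma ad_linear_plane f x y a b c d : ad_linear f x y ->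
  ad_linear f (a *: x + b *: y) (c *: x + d *: y).
Proof. by move=> L v /plane_sub; apply: L. Qed.

Lemma ad_linear_scale f x y z : ad_linear f x y -> ad_linear (z *: f) x y.
Proof.
move=> L v pv; rewrite !(acsZl Hbr) !(ad_linearZ L) ?L ?scalerA 1?mulrC //.
exact: planeZ.
Qed.

Definition ad_triangular r p q f x y :=
  [/\ frame br f x y, ad_linear f x y, br f x = r *: x
    & br f y = p *: x + q *: y].

(** The four scalar equations say that the new basis intertwines the old matrix of ad [f] with the
    new triangular one. *)
Lemma ad_triangular_plane r p q r' p' q' a b c d f x y :
  ad_triangular r p q f x y -> a * d - b * c != 0 ->
  a * r + b * p = r' * a -> b * q = r' * b ->
  c * r + d * p = p' * a + q' * c -> d * q = p' * b + q' * d ->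
  ad_triangular r' p' q' f (a *: x + b *: y) (c *: x + d *: y).
Proof.
move=> [F L Ax Ay] det e1 e2 e3 e4.
have lin k l : br f (k *: x + l *: y) = (k * r + l * p) *: x + (l * q) *: y.
  rewrite (acsDr Hbr) (ad_linearZ L _ (planel x y)) (ad_linearZ L _ (planer x y)).
  by rewrite Ax Ay; lincomb x y x y.
split; first exact: frame_plane.
- exact: ad_linear_plane.
- by rewrite lin e1 e2; lincomb x y x y.
- by rewrite lin e3 e4; lincomb x y x y.
Qed.

Lemma ad_triangular_scale r p q z f x y : ad_triangular r p q f x y -> z != 0 ->
  ad_triangular (z^* * r) (z^* * p) (z^* * q) (z *: f) x y.
Proof.
move=> [F L Ax Ay] z0; split; first exact: frame_scale.
- exact: ad_linear_scale.
- by rewrite (acsZl Hbr) (ad_linearZ L (z^*) (planel x y)) Ax scalerA.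
- rewrite (acsZl Hbr) (ad_linearZ L (z^*) (planer x y)) Ay.
  by lincomb x y x y.
Qed.

Hypothesis not_nilpotent : ~ forall v1 v2 v3 v4, br v1 (br v2 (br v3 v4)) = 0.
(** This holds when s' + J s' has complex dimension 2; it rules out a rank one ad [f] whose image
    also contains [br f ('i *: f)]. *)
Hypothesis derived_large : forall x, ~ forall v w, exists k, br v w = k *: x.

Definition has_normal_frame :=
  exists c p l d f x y, admissible c p l d /\ normal_frame c p l d f x y.

(** If [q] is outside the region, then [q^-1] is inside: rescaling [f] turns the eigenvalues 1, [q]
    into [q^-1], 1, and exchanging [x] and [y] restores the order. *)
Lemma diagonal_unit_ratio q f x y : ad_triangular 1 0 q f x y ->
  q != 0 -> has_normal_frame.
Proof.
have std r f' x' y' : ad_triangular 1 0 r f' x' y' -> r != 0 ->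
    normal_ratio r -> has_normal_frame.
  move=> [F L Ax Ay] r0 nr; exists 0, 0, r, 0.
  have [||||f2 N] := @normal_frame_shift f' x' y' F 0 r r0.
  - by rewrite Ax scale1r.
  - by rewrite L ?Ax ?scale1r //; apply: planel.
  - exact: Ay.
  - by rewrite L ?Ay //; apply: planer.
  by exists f2, x', y'; split=> //; constructor.
move=> T q0; case: (normal_ratioVr q0) => nq; first exact: std T q0 nq.
have z0 : (q^-1)^* != 0 by rewrite conjC_eq0 invr_eq0.
have := ad_triangular_scale T z0; rewrite conjCK mulr1 mulr0 mulVf // => T'.
apply: (@std q^-1 _ (0 *: x + 1 *: y) (1 *: x + 0 *: y)) nq.
  apply: (ad_triangular_plane T'); try ring.
  by rewrite mul0r mulr1 add0r oppr_eq0 oner_eq0.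
by rewrite invr_eq0.
Qed.

(** The [x]-component of [br f ('i *: f)] is in the image of ad [f] and is shifted away. The
    [y]-component is nonzero, since otherwise all brackets would be multiples of [x], and it is
    absorbed into [y]. *)
Lemma rank_one f x y : ad_triangular 1 0 0 f x y -> has_normal_frame.
Proof.
move=> [F L Ax Ay]; have [a [b w]] := frame_br F f ('i *: f).
rewrite scale1r in Ax; rewrite !scale0r addr0 in Ay.
have lin k l : br f (k *: x + l *: y) = k *: x.
  rewrite (acsDr Hbr) (ad_linearZ L _ (planel x y)) (ad_linearZ L _ (planer x y)).
  by rewrite Ax Ay scaler0 addr0.
have b0 : b != 0.
  apply/eqP=> b0; apply: (derived_large (x := x)) => v v'.
  have [z [u [pu ->]]] := ad_frame F v; have [z' [u' [pu' ->]]] := ad_frame F v'.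
  have plin k t : plane x y t -> exists m, br f (k *: t) = m *: x.
    by move=> /(planeZ k)[m [n ->]]; exists m; rewrite lin.
  have [k1 e1] := plin (z^*) _ pu'; have [k2 e2] := plin (z'^*) _ pu.
  exists ('Im (z^* * z') * a + k1 - k2).
  rewrite (br_frame_frame Hbr F _ _ pu pu') e1 e2 w b0.
  by lincomb x y x y.
pose v := - (a / 2) *: x.
have iNi : 'i *: (- 'i *: v) = v.
  by rewrite scalerA mulrN -expr2 sqrCi opprK scale1r.
have pu : plane x y (- 'i *: v) by rewrite /v; do 2!apply: planeZ; apply: planel.
exists 0, 0, 0, 1, (f - 'i *: v), x, (b *: y); split; first by constructor.
have n2 : 2%:R != 0 :> C by rewrite pnatr_eq0.
rewrite -scaleNr; split.
- apply: (frame_planeE (frame_shift F pu) (a := 1) (b := 0) (c := 0) (d := b)).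
  + by lincomb x y x y.
  + by lincomb x y x y.
  + by rewrite mulr0 subr0 mul1r.
- by rewrite (br_shift Hbr F pu (planel x y)).
- rewrite (br_shift Hbr F pu (planeZ _ (planel x y))) scale0r addr0.
  by rewrite (ad_linearZ L _ (planel x y)) Ax.
- rewrite (br_shift Hbr F pu (planeZ _ (planer x y))).
  by rewrite (ad_linearZ L _ (planer x y)) Ay !scale0r scaler0 addr0.
- rewrite (br_shift Hbr F pu (planeZ _ (planeZ _ (planer x y)))).
  by rewrite scalerA (ad_linearZ L _ (planer x y)) Ay !scale0r addr0 !scaler0.
- rewrite (br_shift_self Hbr F pu) w iNi /v (ad_linearZ L _ (planel x y)) Ax.
  by lincomb_with x y x y; field.
Qed.

(** Either the eigenvalues differ and ad [f] is diagonalizable, or it is the identity, or it is a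
    Jordan block whose off-diagonal entry [p] is normalized to 1 by rescaling [x]. *)
Lemma unit_eigenvalue p q f x y : ad_triangular 1 p q f x y -> has_normal_frame.
Proof.
move=> T; have [q1|q1] := eqVneq q 1; last first.
  have q1' : q - 1 != 0 by rewrite subr_eq0.
  (* The second vector is an eigenvector for [q]. *)
  have T' : ad_triangular 1 0 q f (1 *: x + 0 *: y) ((p / (q - 1)) *: x + 1 *: y).
    apply: (ad_triangular_plane T); try ring; try by field.
    by rewrite mul0r subr0 mulr1 oner_eq0.
  have [q0|q0] := eqVneq q 0; last exact: diagonal_unit_ratio T' q0.
  by move: T'; rewrite q0; apply: rank_one.
have [p0|p0] := eqVneq p 0.
  by move: T; rewrite q1 p0 => T; apply: diagonal_unit_ratio T (oner_neq0 _).
have : ad_triangular 1 1 1 f (p *: x + 0 *: y) (0 *: x + 1 *: y).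
  apply: (ad_triangular_plane T); rewrite ?q1; try ring.
  by rewrite mulr1 mul0r subr0.
move: (p *: x + _) (_ + 1 *: y) => {p0 q1 T} x' y' {}[F L Ax Ay].
have [||||f2 N] := @normal_frame_shift f x' y' F 1 1 (oner_neq0 _).
- by rewrite Ax scale1r.
- by rewrite L ?Ax ?scale1r //; apply: planel.
- exact: Ay.
- by rewrite L ?Ay //; apply: planer.
by exists 0, 1, 1, 0, f2, x', y'; split=> //; constructor.
Qed.

Lemma ad_triangular_normal r p q f x y :
  ad_triangular r p q f x y -> has_normal_frame.
Proof.
have unit r' p' q' f' x' y' : ad_triangular r' p' q' f' x' y' -> r' != 0 ->
    has_normal_frame.
  move=> T r0; have z0 : (r'^-1)^* != 0 by rewrite conjC_eq0 invr_eq0.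
  have := ad_triangular_scale T z0; rewrite conjCK mulVf //.
  exact: unit_eigenvalue.
move=> T; have [r0|] := eqVneq r 0; last exact: unit T.
have [q0|q0] := eqVneq q 0.
  case: not_nilpotent; case: T => [F L Ax Ay]; apply: (frame_nilpotent Hbr F).
  move=> _ [a [b ->]]; rewrite (acsDr Hbr) (ad_linearZ L _ (planel x y)).
  rewrite (ad_linearZ L _ (planer x y)) Ax Ay r0 q0 !scale0r scaler0 add0r addr0.
  rewrite scalerA (ad_linearZ L _ (planel x y)) Ax r0.
  by rewrite scale0r scaler0.
(* The eigenvector for the nonzero eigenvalue [q] is put first. *)
suff T' : ad_triangular q 0 0 f ((p / q) *: x + 1 *: y) (1 *: x + 0 *: y).
  exact: unit T' q0.
apply: (ad_triangular_plane T); rewrite ?r0; try ring; try by field.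
by rewrite mulr0 mulr1 sub0r oppr_eq0 oner_eq0.
Qed.

(** A complex linear ad [f] has an eigenvector, hence a triangular matrix. *)
Lemma ad_linear_normal f x y : frame br f x y -> ad_linear f x y ->
  has_normal_frame.
Proof.
move=> F L; have [al [ga Ax]] := frame_br F f x.
have [be [de Ay]] := frame_br F f y.
have [ga0|ga0] := eqVneq ga 0.
  apply: (@ad_triangular_normal al be de f x y); split=> //.
  by rewrite Ax ga0 scale0r addr0.
pose s := sqrtC ((al - de) ^+ 2 + 4 * (be * ga)).
have ss : s * s = (al - de) ^+ 2 + 4 * (be * ga) by rewrite -expr2 sqrtCK.
have n2 : 2%:R != 0 :> C by rewrite pnatr_eq0.
(* A root of the characteristic polynomial, by the quadratic formula. Its eigenvector is
   [(r - de) *: x + ga *: y], completed to a basis by [x] since [ga != 0]; ad [f] maps [x] to the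
   eigenvector plus [(al + de - r) *: x]. *)
pose r := (al + de + s) / 2.
have rr : r * r = r * (al + de) - (al * de - be * ga).
  by rewrite /r; field: ss.
have lin k l : br f (k *: x + l *: y) = k *: br f x + l *: br f y.
  rewrite (acsDr Hbr) (ad_linearZ L _ (planel x y)).
  by rewrite (ad_linearZ L _ (planer x y)).
apply: (@ad_triangular_normal r 1 (al + de - r) f ((r - de) *: x + ga *: y)
  (1 *: x + 0 *: y)); split.
- by apply: frame_plane; rewrite // mulr0 sub0r mulr1 oppr_eq0.
- exact: ad_linear_plane.
- by rewrite lin Ax Ay; lincomb_with x y x y; ring: rr.
- by rewrite lin Ax Ay; lincomb x y x y.
Qed.

(** The map D = A J - J A at [v], where A is ad [f]. *)
Definition ad_defect f v := br f ('i *: v) - 'i *: br f v.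

Lemma ad_defectE f v : br f ('i *: v) = 'i *: br f v + ad_defect f v.
Proof. by rewrite addrC subrK. Qed.

Lemma ad_defectZ f k v : ad_defect f (k *: v) = k^* *: ad_defect f v.
Proof.
have ii : 'i * 'i = -1 :> C by rewrite -expr2 sqrCi.
rewrite /ad_defect scalerA (acsZ_rect Hbr f ('i * k)) (acsZ_rect Hbr f k).
rewrite ReMil ImMil [k^*]Crect Re_conj Im_conj.
by lincomb_with (br f v) (br f ('i *: v)) v v; ring: ii.
Qed.

Lemma ad_defectD f u v : ad_defect f (u + v) = ad_defect f u + ad_defect f v.
Proof. by rewrite /ad_defect scalerDr !(acsDr Hbr) scalerDr opprD addrACA. Qed.

Lemma adZ f k v : br f (k *: v) = k *: br f v + 'Im k *: ad_defect f v.
Proof.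
rewrite acsZ_rect // ad_defectE {3}[k]Crect.
by lincomb (br f v) (ad_defect f v) v v.
Qed.

Lemma ad_defect_plane f x y v : frame br f x y -> plane x y (ad_defect f v).
Proof.
move=> F; rewrite /ad_defect -scaleNr; apply: planeD (frame_br F _ _) _.
exact: planeZ (frame_br F _ _).
Qed.

(** A restatement of [ad_ad_i]: A kills the image of D. *)
Lemma ad_ad_defect f x y v : frame br f x y -> plane x y v ->
  br f (ad_defect f v) = 0.
Proof.
move=> F pv; rewrite (acsDr Hbr) acsN // (ad_ad_i Hbr F pv) subrr //.
Qed.

Lemma adZ_ad_defect f x y v k : frame br f x y -> plane x y v ->
  br f (k *: ad_defect f v) = 0.
Proof.
move=> F pv; rewrite -[k]conjCK -ad_defectZ.
by apply: (ad_ad_defect F); apply: planeZ.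
Qed.

(** By antilinearity the image of D is stable under complex scalars, so A kills both terms of D D =
    A J D - J A D. *)
Lemma ad_defect2 f x y v : frame br f x y -> plane x y v ->
  ad_defect f (ad_defect f v) = 0.
Proof.
move=> F pv; rewrite {1}/ad_defect (adZ_ad_defect _ F pv) (ad_ad_defect F pv).
by rewrite scaler0 subr0.
Qed.

(** Let l be the defect of [x]. Since A fixes [x] and kills all multiples of l, a shift by a
    multiple of [x] reduces [br f ('i *: f)] to a multiple of l. Its vanishing or not separates the
    two admissible cases with [c = 1]. *)
Lemma twisted_normal f x : frame br f x (ad_defect f x) -> br f x = x ->
  has_normal_frame.
Proof.
move El: (ad_defect f x) => l F Ax; have [a [b w]] := frame_br F f ('i *: f).
have px := planel x l; have pl := planer x l.
have Al k : br f (k *: l) = 0 by rewrite -El; apply: adZ_ad_defect F px.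
have A k : br f (k *: x) = k *: x + 'Im k *: l by rewrite adZ Ax El.
pose v := - (a / 2) *: x.
have pv : plane x l v by apply: planeZ.
have iNi : 'i *: (- 'i *: v) = v.
  by rewrite scalerA mulrN -expr2 sqrCi opprK scale1r.
have pu := planeZ (- 'i) pv; have F2 := frame_shift F pu.
have n2 : 2%:R != 0 :> C by rewrite pnatr_eq0.
have w2 : br (f + - 'i *: v) ('i *: (f + - 'i *: v)) = (b - 'Im a) *: l.
  rewrite (br_shift_self Hbr F pu) iNi w /v A raddfN /=.
  have -> : 'Im (a / 2) = 'Im a / 2.
    by rewrite ImMr // rpredV realn.
  by lincomb_with x l x l; field.
have sh t : plane x l t -> br (f + - 'i *: v) t = br f t.
  exact: (br_shift Hbr F pu).
have [g0|g0] := eqVneq (b - 'Im a) 0.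
  exists 1, 0, 0, 0, (f + - 'i *: v), x, l; split; first by constructor.
  split; rewrite // ?w2 ?g0 ?(sh _ px) ?(sh _ pl) ?(sh _ (planeZ _ px))
    ?(sh _ (planeZ _ pl)) //.
  - by rewrite ad_defectE Ax El scale1r.
  - by rewrite -[l]scale1r Al !scale0r addr0.
  - by rewrite Al !scale0r addr0 scaler0.
move: (b - 'Im a) g0 w2 => g g0 w2.
(* This is A applied to [g^* *: x], hence fixed by A; as D is antilinear its defect is [g *: l], the
   new [y]. *)
pose x2 := g^* *: x + 'Im (g^*) *: l.
have px2 : plane x l x2 by exists (g^*), ('Im (g^*)).
exists 1, 0, 0, 1, (f + - 'i *: v), x2, (g *: l); split; first by constructor.
split.
- apply: (frame_planeE F2 (c := 0) (d := g)) => //.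
    by lincomb x l x l.
  by rewrite mulr0 subr0 mulf_neq0 // conjC_eq0.
- by rewrite (sh _ px2) /x2 (acsDr Hbr) Al addr0 A.
- rewrite (sh _ (planeZ _ px2)) /x2 scalerDr !scalerA (acsDr Hbr) Al addr0 A.
  have eg : 'Re g = g - 'i * 'Im g by rewrite {2}[g]Crect addrK.
  by rewrite ImMil Re_conj Im_conj eg; lincomb x l x l.
- by rewrite (sh _ (planeZ _ pl)) Al !scale0r addr0.
- by rewrite (sh _ (planeZ _ (planeZ _ pl))) scalerA Al !scale0r addr0 scaler0.
- by rewrite w2 scale1r.
Qed.

Lemma ad_defect_normal f x y v : frame br f x y -> plane x y v ->
  ad_defect f v != 0 -> has_normal_frame.
Proof.
move=> F pv; move El: (ad_defect f v) => l l0.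
have pl : plane x y l by rewrite -El; apply: ad_defect_plane F.
have dl : ad_defect f l = 0 by rewrite -El (ad_defect2 F pv).
have {x y F pv pl dl} F : frame br f v l.
  (* The vector [v] is no multiple of [l], because D kills [l] but sends [v] to [l != 0]. *)
  have Fl : frame br f l v.
    apply: (plane_basis F pl pv l0) => k; apply: contraNneq l0 => e.
    by rewrite -El e ad_defectZ dl scaler0.
  by apply: (frame_planeE Fl (a := 0) (b := 1) (c := 1) (d := 0));
    [lincomb v l v l | lincomb v l v l |
     rewrite mul0r mulr1 sub0r oppr_eq0 oner_eq0].
have Al k : br f (k *: l) = 0.
  by rewrite -El; apply: adZ_ad_defect F (planel v l).
have [a [b Av]] := frame_br F f v.
(* If [a = 0], then A maps the plane into the multiples of [l], which it kills, so the algebra is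
   nilpotent. Otherwise rescaling [f] makes this coefficient 1. *)
have [a0|a0] := eqVneq a 0.
  case: not_nilpotent; apply: (frame_nilpotent Hbr F) => _ [m [n ->]].
  rewrite (acsDr Hbr) Al addr0 adZ El Av a0 scale0r add0r (acsDr Hbr).
  by rewrite scalerA !Al addr0.
have z0 : (a^-1)^* != 0 by rewrite conjC_eq0 invr_eq0.
have F2 := frame_scale F z0.
pose f2 := (a^-1)^* *: f.
have A2 u : br f2 u = br f (a^-1 *: u) by rewrite /f2 acsZl // conjCK.
have [g A2v] : exists g, br f2 v = v + g *: l.
  exists (b / a + 'Im (a^-1)); rewrite A2 adZ Av El.
  by lincomb_with v l v l; field.
(* It differs from [v] by a multiple of [l], which ad [f2] kills, so ad [f2] fixes it. *)
pose x := br f2 v.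
have dx : ad_defect f2 x = (a^-1)^* *: l.
  rewrite {1}/ad_defect /x A2v scalerDr !(acsDr Hbr) !A2 !scalerA !Al !addr0.
  rewrite [_ * 'i]mulrC -scalerA ad_defectE.
  by rewrite ad_defectZ El addrAC subrr add0r.
apply: (@twisted_normal f2 x); rewrite ?dx; last first.
  by rewrite /x [in LHS]A2v (acsDr Hbr) [X in _ + X]A2 scalerA Al addr0.
apply: (frame_planeE F2 (a := 1) (b := g) (c := 0) (d := (a^-1)^*)).
- by rewrite scale1r.
- by rewrite scale0r add0r.
- by rewrite mulr0 subr0 mul1r.
Qed.

Lemma normal_frame_exists f x y : frame br f x y -> has_normal_frame.
Proof.
move=> F; have [dx|] := eqVneq (ad_defect f x) 0; last first.
  exact: ad_defect_normal F (planel x y).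
have [dy|] := eqVneq (ad_defect f y) 0; last first.
  exact: ad_defect_normal F (planer x y).
apply: (ad_linear_normal F) => _ [a [b ->]].
by rewrite ad_defectE ad_defectD !ad_defectZ dx dy !scaler0 !addr0.
Qed.

End NormalForms.

(** * Uniqueness of the parameters *)

Section Uniqueness.
Variables (C : numClosedFieldType) (V : lmodType C) (br : V -> V -> V).
Implicit Types (a b c d k l m n p q r s z : C) (f x y u v w : V).
Hypothesis Hbr : acs_bracket br.

Lemma normal_ratio_neq0 l : normal_ratio l -> l != 0.
Proof.
case/orP=> [/andP[l0 _]|/andP[/eqP l1 _]]; first by rewrite -normr_gt0.
by rewrite -normr_eq0 l1 oner_eq0.
Qed.

Lemma normal_ratio_le1 l : normal_ratio l -> `|l| <= 1.
Proof.
by case/orP=> [/andP[_ /ltW]|/andP[/eqP-> _]].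
Qed.

(** Both norms are at most 1 with product 1, so both numbers lie on the unit circle and are
    conjugate; their imaginary parts are nonnegative, hence zero. *)
Lemma normal_ratioV_eq l l' : normal_ratio l -> normal_ratio l' -> l * l' = 1 ->
  l = l'.
Proof.
move=> nl nl' ll'; have l0 := normal_ratio_neq0 nl.
have el' : l' = l^-1 by rewrite -[LHS](mulKf l0) ll' mulr1.
have l1 : `|l| = 1.
  apply/eqP; rewrite eq_le (normal_ratio_le1 nl) /=.
  by have := normal_ratio_le1 nl'; rewrite el' normfV invf_le1 ?normr_gt0.
have {}el' : l' = l^* by rewrite el' invC_norm l1 expr1n invr1 mul1r.
move: nl nl'; rewrite /normal_ratio el' norm_conjC l1 ltxx eqxx Im_conj /=.
rewrite andbF /= oppr_ge0 => Il Il'.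
by apply/esym/CrealP; apply/Creal_ImP/eqP; rewrite eq_le Il Il'.
Qed.

Lemma normal_frame_ad c p l d f x y m n : normal_frame br c p l d f x y ->
  br f (m *: x + n *: y) = (m + n * p) *: x + ('Im m * c + n * l) *: y.
Proof.
case=> F Ax Aix Ay Aiy _; rewrite (acsDr Hbr) (adZ Hbr f m x) (adZ Hbr f n y).
rewrite /ad_defect Aix Aiy Ax Ay subrr.
by lincomb x y x y.
Qed.

Lemma normal_frame_bracket c p l d f x y a b e a' b' e' :
  normal_frame br c p l d f x y ->
  br (a *: f + (b *: x + e *: y)) (a' *: f + (b' *: x + e' *: y)) =
  (a^* * b' + a^* * e' * p - (a'^* * b + a'^* * e * p)) *: x
  + ('Im (a^* * a') * d + 'Im (a^* * b') * c + a^* * e' * l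
     - ('Im (a'^* * b) * c + a'^* * e * l)) *: y.
Proof.
move=> N; rewrite (br_frame_frame Hbr (nf_frame N)); try by do 2!eexists.
rewrite !scalerDr !scalerA !(normal_frame_ad _ _ N) (nf_w N).
by lincomb x y x y.
Qed.

Lemma frame_free2 f x y a b a' b' : frame br f x y ->
  a *: x + b *: y = a' *: x + b' *: y -> a = a' /\ b = b'.
Proof.
move=> F e; have [|_] := frame_free F (a := 0) (b := a - a') (c := b - b').
  have : a *: x + b *: y - (a' *: x + b' *: y) = 0 by rewrite e subrr.
  by move=> e0; rewrite -[RHS]e0; lincomb f x y x.
by move=> /eqP; rewrite subr_eq0 => /eqP-> /eqP; rewrite subr_eq0 => /eqP->.
Qed.

Section TwoFrames.
Variables (c p l d c' p' l' d' : C) (f x y f' x' y' : V).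
Hypothesis N : normal_frame br c p l d f x y.
Hypothesis N' : normal_frame br c' p' l' d' f' x' y'.

(** The plane is intrinsic: [x], [c *: y], [d *: y] and [l *: y] are obtained from brackets by
    complex combinations, and in every admissible case one of [c], [d], [l] is nonzero. *)
Lemma admissible_plane : admissible c p l d ->
  forall v, plane x y v -> plane x' y' v.
Proof.
have px : plane x' y' x by rewrite -(nf_x N); apply: frame_br (nf_frame N') _ _.
have pbr v w : plane x' y' (br v w) by apply: frame_br (nf_frame N') _ _.
have cy : plane x' y' (c *: y).
  have -> : c *: y = br f ('i *: x) + (- 'i) *: x.
    by rewrite (nf_ix N); lincomb x y x y.
  by apply: planeD => //; apply: planeZ.
have dy : plane x' y' (d *: y) by rewrite -(nf_w N).
have ly : plane x' y' (l *: y).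
  have -> : l *: y = br f y + (- p) *: x by rewrite (nf_y N); lincomb x y x y.
  by apply: planeD => //; apply: planeZ.
move=> adm; suff py : plane x' y' y.
  by move=> v [a [b ->]]; apply: planeD; apply: planeZ.
case: adm cy dy ly => [||||r /normal_ratio_neq0 r0]; rewrite ?scale1r // => _ _.
by move=> /(planeZ r^-1); rewrite scalerA mulVf // scale1r.
Qed.

Hypothesis sub : forall v, plane x y v -> plane x' y' v.
Hypothesis sub' : forall v, plane x' y' v -> plane x y v.

Lemma two_frames_f : exists z u, [/\ z != 0, plane x y u & f' = z *: f + u].
Proof.
have [z [u [pu e]]] := ad_frame (nf_frame N) f'.
exists z, u; split=> //; apply/eqP=> z0.
have [a [b eu]] := sub pu.
have [|/eqP] := frame_free (nf_frame N') (a := 1) (b := - a) (c := - b).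
  by rewrite e z0 eu; lincomb f x' y' f.
by rewrite oner_eq0.
Qed.

(** On the plane ad [f'] is ad [f] after a complex scalar, so it is complex linear if ad [f] is. *)
Lemma two_frames_c : c = 0 -> c' = 0.
Proof.
move=> c0; have [z [u [z0 pu e]]] := two_frames_f.
have L : ad_linear br f x y.
  move=> _ [a [b ->]]; rewrite !(normal_frame_ad _ _ N) scalerDr !scalerA.
  by rewrite (normal_frame_ad _ _ N) c0; lincomb x y x y.
have px' := sub' (planel x' y').
have: br f' ('i *: x') = 'i *: br f' x'.
  rewrite e !(br_frame Hbr (nf_frame N)) //; last exact: planeZ.
  by rewrite scalerA mulrC -scalerA L //; apply: planeZ.
rewrite (nf_ix N') (nf_x N') => e1.
have e0 : 'i *: x' + c' *: y' - 'i *: x' = 0 by rewrite e1 subrr.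
have [|_ _] // := frame_free (nf_frame N') (a := 0) (b := 0) (c := c').
by rewrite -[RHS]e0; lincomb f' x' y' f'.
Qed.

(** For [d = 0] the bracket [d' *: y'] of [f'] and ['i *: f'] lies in the image of ad [f], hence of
    ad [f']. When [p' = l' = 0], that image contains no nonzero multiple of [y']. *)
Lemma two_frames_d : p' = 0 -> l' = 0 -> d = 0 -> d' = 0.
Proof.
move=> p0 l0 d0; have [z [u [z0 pu e]]] := two_frames_f.
have [t pt et] : exists2 t, plane x y t & br f' ('i *: f') = br f t.
  exists (z^* *: ('i *: u) - ('i * z)^* *: u).
    by rewrite -scaleNr; apply: planeD; do ?apply: planeZ.
  rewrite e scalerDr scalerA (br_frame_frame Hbr (nf_frame N)) //.
    by rewrite (nf_w N) d0 scale0r scaler0 add0r (acsDr Hbr) (acsN Hbr).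
  exact: planeZ.
have [m [n et']] := sub (planeZ ((z^*)^-1) pt).
have : br f' (m *: x' + n *: y') = d' *: y'.
  rewrite -(nf_w N') et -et' e (br_frame Hbr (nf_frame N)) //.
    by rewrite scalerA divff ?scale1r // conjC_eq0.
  exact: planeZ.
rewrite (normal_frame_ad _ _ N') p0 l0 !mulr0 !addr0 => e1.
have [|m0 <-] := @frame_free2 f' x' y' m ('Im m * c') 0 d' (nf_frame N').
  by rewrite e1 scale0r add0r.
by rewrite m0 raddf0 mul0r.
Qed.

(** Both matrices of ad are complex linear here, and the second is similar to a multiple of the
    first; a, b, g, h are the entries of the change of basis. *)
Lemma two_frames_ratio : c = 0 -> c' = 0 -> exists z a b g h,
  [/\ a * h - b * g != 0,
    z * (a + b * p) = a /\ z * (b * l) = b &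
    z * (g + h * p) = p' * a + l' * g /\ z * (h * l) = p' * b + l' * h].
Proof.
move=> c0 c0'; have [z [u [z0 pu e]]] := two_frames_f.
have [a [b ex]] := sub' (planel x' y').
have [g [h ey]] := sub' (planer x' y').
(* With determinant zero, Cramer's combinations of [x'] and [y'] would vanish; freeness then makes
   the entries zero, and with them [x']. *)
have det0 : a * h - b * g != 0.
  apply/eqP=> det0; have F' := nf_frame N'.
  have [|h0 b0] := @frame_free2 f' x' y' h (- b) 0 0 F'.
    have -> : h *: x' + - b *: y' = (a * h - b * g) *: x.
      by rewrite ex ey; lincomb x y x y.
    by rewrite det0; lincomb x x' y' x.
  have [|g0 a0] := @frame_free2 f' x' y' (- g) a 0 0 F'.
    have -> : - g *: x' + a *: y' = (a * h - b * g) *: y.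
      by rewrite ex ey; lincomb x y x y.
    by rewrite det0; lincomb y x' y' x.
  have [|/eqP] := @frame_free2 f' x' y' 1 0 0 0 F'.
    have {}b0 : b = 0 by apply/eqP; rewrite -oppr_eq0 b0.
    by rewrite ex a0 b0; lincomb x y y' x.
  by rewrite oner_eq0.
have Ax : br f (z^* *: x') = x'.
  by rewrite -(br_frame Hbr (nf_frame N) z pu (sub' (planel x' y'))) -e (nf_x N').
have Ay : br f (z^* *: y') = p' *: x' + l' *: y'.
  by rewrite -(br_frame Hbr (nf_frame N) z pu (sub' (planer x' y'))) -e (nf_y N').
rewrite ex scalerDr !scalerA (normal_frame_ad _ _ N) c0 mulr0 add0r in Ax.
rewrite ex ey scalerDr !scalerA (normal_frame_ad _ _ N) c0 mulr0 add0r in Ay.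
have [e1 e2] := frame_free2 (nf_frame N) Ax.
have [|e3 e4] := @frame_free2 f x y (z^* * g + z^* * h * p) (z^* * h * l)
    (p' * a + l' * g) (p' * b + l' * h) (nf_frame N).
  by rewrite Ay; lincomb x y x y.
exists (z^*), a, b, g, h; split=> //; split.
- by rewrite -[RHS]e1; ring.
- by rewrite -[RHS]e2; ring.
- by rewrite -e3; ring.
- by rewrite -e4; ring.
Qed.

End TwoFrames.

(** Similarity preserves trace and determinant: [z * (1 + l) = 1 + l'] and [z * z * l = l'].
    Eliminating [z] gives an equation that factors as [(l' - l) * (1 - l * l') = 0]. *)
Lemma conjugate_ratio z a b g h p l p' l' : a * h - b * g != 0 ->
  z * (a + b * p) = a -> z * (b * l) = b ->
  z * (g + h * p) = p' * a + l' * g -> z * (h * l) = p' * b + l' * h ->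
  z * (1 + l) = 1 + l' /\ (l = l' \/ l * l' = 1).
Proof.
set D := _ - _ => D0 e1 e2 e3 e4.
have tr : z * (1 + l) = 1 + l'.
  apply: (mulIf D0); transitivity (h * (z * (a + b * p)) - g * (z * (b * l))
    + a * (z * (h * l)) - b * (z * (g + h * p))); first by rewrite /D; ring.
  by rewrite e1 e2 e3 e4 /D; ring.
have det : z * z * l = l'.
  apply: (mulIf D0); transitivity ((z * (a + b * p)) * (z * (h * l))
    - (z * (g + h * p)) * (z * (b * l))); first by rewrite /D; ring.
  by rewrite e1 e2 e3 e4 /D; ring.
split=> //; have : (l' - l) * (1 - l * l') = 0.
  transitivity ((1 + l) * (1 + l) * l' - (1 + l') * (1 + l') * l); first by ring.
  by rewrite -tr -{1}det; ring.
move/eqP; rewrite mulf_eq0 !subr_eq0 => /orP[/eqP->|/eqP<-]; by [left | right].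
Qed.

(** The invariants [c] and [d] settle all pairs except those among the last two admissible families,
    for which the eigenvalue ratio is compared. *)
Lemma normal_frame_unique c p l d c' p' l' d' f x y f' x' y' :
  admissible c p l d -> admissible c' p' l' d' ->
  normal_frame br c p l d f x y -> normal_frame br c' p' l' d' f' x' y' ->
  [/\ c = c', p = p', l = l' & d = d'].
Proof.
move=> A A' N N'.
have sub := admissible_plane N N' A; have sub' := admissible_plane N' N A'.
have c12 := two_frames_c N N' sub sub'; have c21 := two_frames_c N' N sub' sub.
have d12 := two_frames_d N N' sub; have d21 := two_frames_d N' N sub'.
have rat := two_frames_ratio N N' sub sub'.
have n10 : 1 <> 0 :> C by apply/eqP; rewrite oner_eq0.
have n2 : 2%:R != 0 :> C by rewrite pnatr_eq0.
have z1 z : z * (1 + 1) = 1 + 1 -> z = 1.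
  by move=> e; apply: (mulIf n2); rewrite mul1r.
(* A Jordan block is not similar to the identity: ratio 1 forces [z = 1], and then [b = h = 0] makes
   the determinant vanish. [sab_s2] is the same with the roles exchanged. *)
have s2_sab z a b g h r : z * (1 + 1) = 1 + r -> 1 = r \/ 1 * r = 1 ->
    z * (a + b * 1) = a -> z * (g + h * 1) = 0 * a + r * g ->
    a * h - b * g != 0 -> False.
  move=> tr; rewrite mul1r => rr; have r1 : r = 1 by case: rr.
  rewrite r1 in tr *; rewrite (z1 z tr) !mul1r mul0r add0r !mulr1 => e1 e3.
  have -> : b = 0 by apply: (addrI a); rewrite addr0.
  have -> : h = 0 by apply: (addrI g); rewrite addr0.
  by rewrite mulr0 mul0r subrr eqxx.
have sab_s2 z a b g h r : z * (1 + r) = 1 + 1 -> r = 1 \/ r * 1 = 1 ->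
    z * (g + h * 0) = 1 * a + 1 * g -> z * (h * r) = 1 * b + 1 * h ->
    a * h - b * g != 0 -> False.
  move=> tr; rewrite mulr1 => rr; have r1 : r = 1 by case: rr.
  rewrite r1 in tr *; rewrite (z1 z tr) !mul1r mulr0 mulr1 addr0 => e3 e4.
  have -> : a = 0 by apply: (addIr g); rewrite add0r.
  have -> : b = 0 by apply: (addIr h); rewrite add0r.
  by rewrite !mul0r subrr eqxx.
case: A A' c12 c21 d12 d21 rat {N N' sub sub'} =>
  [||||r nr] [||||r' nr'] c12 c21 d12 d21 rat; split=> //;
  try (by case: n10; auto); try (by case/esym: n10; auto).
all: have {rat} [//|//|z [a [b [g [h [det [e1 e2] [e3 e4]]]]]]] := rat.
all: have [tr rr] := conjugate_ratio det e1 e2 e3 e4.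
- by case: (s2_sab z a b g h r').
- by case: rr => [->|]; rewrite ?mul1r.
- by case: (sab_s2 z a b g h r).
- by case: rr => [->|]; rewrite ?mulr1.
- by case: rr => // /(normal_ratioV_eq nr nr').
Qed.

End Uniqueness.

(** * Coordinates in a frame, and isomorphisms between algebras with equal parameters *)

Section Coordinates.
Variables (C : numClosedFieldType) (V : lmodType C) (br : V -> V -> V).
Variables (f x y : V).

Definition frame_comb (t : C * C * C) := t.1.1 *: f + (t.1.2 *: x + t.2 *: y).

Lemma frame_combD k t u : frame_comb
    (k * t.1.1 + u.1.1, k * t.1.2 + u.1.2, k * t.2 + u.2) =
  k *: frame_comb t + frame_comb u.
Proof. by rewrite /frame_comb /=; lincomb f x y f. Qed.

Hypothesis F : frame br f x y.

Lemma frame_comb_surj v : exists t : C * C * C, v == frame_comb t.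
Proof.
have [a [b [c ->]]] := frame_span F v.
by exists (a, b, c); rewrite /frame_comb addrA.
Qed.

Definition frame_coord v := xchoose (frame_comb_surj v).

Lemma frame_coordK v : frame_comb (frame_coord v) = v.
Proof. exact/esym/eqP/(xchooseP (frame_comb_surj v)). Qed.

Lemma frame_comb_inj : injective frame_comb.
Proof.
move=> [[a1 a2] a3] [[b1 b2] b3] /eqP; rewrite -subr_eq0 => /eqP e.
have [|] := frame_free F (a := a1 - b1) (b := a2 - b2) (c := a3 - b3).
  by rewrite -[RHS]e /frame_comb /=; lincomb f x y f.
by move=> /eqP + /eqP + /eqP; rewrite !subr_eq0 => /eqP-> /eqP-> /eqP->.
Qed.

Lemma frame_combK t : frame_coord (frame_comb t) = t.
Proof. by apply: frame_comb_inj; rewrite frame_coordK. Qed.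

End Coordinates.

Section Isomorphism.
Variables (C : numClosedFieldType) (V V' : lmodType C).
Variables (br : V -> V -> V) (br' : V' -> V' -> V').

Lemma normal_frame_image (S : V -> V') c p l d f x y : linear S -> bijective S ->
  (forall v w, S (br v w) = br' (S v) (S w)) ->
  normal_frame br c p l d f x y -> normal_frame br' c p l d (S f) (S x) (S y).
Proof.
move=> linS [T ST TS] mS [F Ax Aix Ay Aiy w].
have SD u v : S (u + v) = S u + S v by have := linS 1 u v; rewrite !scale1r.
have S0 : S 0 = 0 by apply: (addrI (S 0)); rewrite -SD !addr0.
have SZ k v : S (k *: v) = k *: S v by have := linS k v 0; rewrite S0 !addr0.
have pl v : plane (S x) (S y) v -> plane x y (T v).
  by move=> [a [b ->]]; exists a, b; rewrite -!SZ -SD ST.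
split.
- split.
  + move=> v; have [a [b [c' e]]] := frame_span F (T v).
    by exists a, b, c'; rewrite -!SZ -!SD -e TS.
  + move=> a b c' e; apply: (frame_free F); apply: (can_inj ST).
    by rewrite S0 !SD !SZ.
  + move=> u v; rewrite -(TS u) -(TS v) -mS.
    by have [a [b ->]] := frame_br F (T u) (T v); exists a, b; rewrite SD !SZ.
  + move=> u v /pl pu /pl pv; rewrite -(TS u) -(TS v) -mS.
    by rewrite (frame_abelian F pu pv).
- by rewrite -mS Ax.
- by rewrite -!SZ -SD -mS Aix.
- by rewrite -!SZ -SD -mS Ay.
- by rewrite -!SZ -SD -SZ -mS Aiy.
- by rewrite -!SZ -mS w.
Qed.

(** By [normal_frame_bracket] the bracket in coordinates depends only on the four parameters, so the
    map preserving coordinates is an isomorphism. *)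
Lemma normal_frame_iso c p l d f x y f' x' y' :
  acs_bracket br -> acs_bracket br' ->
  normal_frame br c p l d f x y -> normal_frame br' c p l d f' x' y' ->
  exists S : V -> V', [/\ linear S, bijective S
    & forall v w, S (br v w) = br' (S v) (S w)].
Proof.
move=> H H' N N'; have F := nf_frame N; have F' := nf_frame N'.
pose S v := frame_comb f' x' y' (frame_coord F v).
exists S; split.
- move=> k u v; rewrite /S -frame_combD; congr (frame_comb _ _ _ _).
  by apply: (frame_comb_inj F); rewrite frame_combD !frame_coordK.
- exists (fun v => frame_comb f x y (frame_coord F' v)) => v.
    by rewrite /S frame_combK frame_coordK.
  by rewrite /S frame_combK frame_coordK.
- move=> v w; rewrite {2 3}/S /frame_comb (normal_frame_bracket H' _ _ _ _ _ _ N').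
  rewrite -{1}(frame_coordK F v) -{1}(frame_coordK F w) /frame_comb.
  rewrite (normal_frame_bracket H _ _ _ _ _ _ N).
  set m := _ + _ - _; set n := _ + _ - _.
  have e : m *: x + n *: y = frame_comb f x y (0, m, n).
    by rewrite /frame_comb /= scale0r add0r.
  by rewrite /S e frame_combK /frame_comb /= scale0r add0r.
Qed.

End Isomorphism.

(** * The complex vector space defined by J *)

Section ComplexModule.
Variables (R : realType) (g : lieAlgType R) (J : 'End(g)).

(** The alias mentions the proof that J squares to -1, so that the type alone determines the module
    structure over [R[i]]. *)
Definition cplx of (forall v, J (J v) = - v) : Type := g.

Variable J2 : forall v, J (J v) = - v.

HB.instance Definition _ := GRing.Zmodule.copy (cplx J2) g.

Definition cplx_scale (z : R[i]) (v : cplx J2) : cplx J2 :=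
  complex.Re z *: (v : g) + complex.Im z *: J v.

Lemma cplx_scaleA a b v : cplx_scale a (cplx_scale b v) = cplx_scale (a * b) v.
Proof.
case: a b => [a1 a2] [b1 b2]; rewrite /cplx_scale /=.
rewrite (linearD J) !(linearZZ J) /= J2.
rewrite !scalerDr !scalerN !scalerA !scalerDl scaleNr [a2 * b1 *: _ - _]addrC.
by rewrite addrACA.
Qed.

Lemma cplx_scale1 : left_id 1 cplx_scale.
Proof. by move=> v; rewrite /cplx_scale /= scale1r scale0r addr0. Qed.

Lemma cplx_scaleDr : right_distributive cplx_scale +%R.
Proof.
by move=> a u v; rewrite /cplx_scale (linearD J) !scalerDr addrACA.
Qed.

Lemma cplx_scaleDl v : {morph cplx_scale^~ v : a b / a + b}.
Proof. by move=> [a1 a2] [b1 b2]; rewrite /cplx_scale /= !scalerDl addrACA. Qed.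

HB.instance Definition _ := GRing.Zmodule_isLmodule.Build R[i] (cplx J2)
  cplx_scaleA cplx_scale1 cplx_scaleDr cplx_scaleDl.

Definition cplx_bracket (u v : cplx J2) : cplx J2 := [lie (u : g), (v : g)].

Lemma cplx_scaleE z (v : cplx J2) :
  z *: v = (complex.Re z *: (v : g) + complex.Im z *: J v : g).
Proof. by []. Qed.

Lemma cplx_scale_real (r : R) (v : cplx J2) : r%:C%C *: v = (r *: (v : g) : g).
Proof. by rewrite cplx_scaleE /= scale0r addr0. Qed.

Lemma cplx_scale_i (v : cplx J2) : 'i *: v = (J v : g).
Proof. by rewrite -complexiE cplx_scaleE /= scale0r scale1r add0r. Qed.

Lemma lie_skew (u v : g) : [lie u, v] = - [lie v, u].
Proof.
have Dl x y z : [lie x + y, z] = [lie x, z] + [lie y, z] :> g.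
  by have := bracket_linearl z 1 x y; rewrite !scale1r.
have Dr x y z : [lie x, y + z] = [lie x, y] + [lie x, z] :> g.
  by have := bracket_linearr x 1 y z; rewrite !scale1r.
have := bracketxx (u + v); rewrite Dl !Dr !bracketxx addr0 add0r.
by move/eqP; rewrite addr_eq0 => /eqP.
Qed.

Lemma cplx_acs_bracket : (forall u v, [lie J u, J v] = [lie u, v]) ->
  acs_bracket cplx_bracket.
Proof.
move=> Jab; split.
- by move=> x u v; have := bracket_linearr (x : g) 1 u v; rewrite !scale1r.
- move=> x r u /RRe_real <-; rewrite !cplx_scale_real.
  have r0 : [lie (x : g), 0] = 0 :> g.
    have := bracket_linearr (x : g) (-1) 0 0.
    by rewrite scaler0 addr0 scaleN1r addNr.
  by have := bracket_linearr (x : g) (complex.Re r) u 0; rewrite r0 !addr0.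
- by move=> x; apply: bracketxx.
- by move=> x y; apply: lie_skew.
- by move=> x y; rewrite !cplx_scale_i; apply: Jab.
- exact: bracket_jacobi.
Qed.

End ComplexModule.

(** * Holomorphic isomorphisms as complex linear maps *)

Section HolomorphicIsomorphism.
Variables (R : realType) (g1 g2 : lieAlgType R) (J1 : 'End(g1)) (J2 : 'End(g2)).
Variables (sq1 : forall v, J1 (J1 v) = - v) (sq2 : forall v, J2 (J2 v) = - v).

Lemma holomorphically_isomorphicP :
  holomorphically_isomorphic J1 J2 <->
  exists S : cplx sq1 -> cplx sq2, [/\ linear S, bijective S
    & forall u v, S (cplx_bracket u v) = cplx_bracket (S u) (S v)].
Proof.
split=> [[al [bij mor JJ]]|[S [linS bij mor]]].
  exists al; split=> // z u v.
  by rewrite !cplx_scaleE (linearD al) (linearD al) !(linearZZ al) /= JJ.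
have lin : linear (S : g1 -> g2).
  by move=> r u v; have := linS r%:C%C u v; rewrite !cplx_scale_real.
pose L := GRing.isLinear.Build R g1 g2 *:%R S lin.
pose S' : {linear g1 -> g2} := HB.pack (S : g1 -> g2) L.
exists (linfun S'); split.
- have bij' : bijective (S : g1 -> g2) := bij.
  by apply: (eq_bij bij') => v; rewrite lfunE.
- by move=> u v; rewrite !lfunE /= mor.
- move=> v; rewrite !lfunE /=.
  have S0 : S 0 = 0.
    by have := linS (-1) 0 0; rewrite scaler0 addr0 scaleN1r addNr.
  by have := linS 'i v 0; rewrite S0 !addr0 !cplx_scale_i.
Qed.

End HolomorphicIsomorphism.

(** * The models and their parameters *)

Section Models.
Variable R : realType.
Local Notation co := Defs.co.

(** The parameters [c], [p], [l], [d] of the normal frame f1, e1, e3 of each model. *)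
Definition model_params (m : model R) : R[i] * R[i] * R[i] * R[i] :=
  match m with
  | AffC_R2_J => (1, 0, 0, 0)
  | S1_J1 => (1, 0, 0, 1)
  | S1_J2 => (0, 0, 0, 1)
  | S2_J => (0, 1, 1, 0)
  | Sab_J p => (0, 0, Complex (val p).1 (val p).2, 0)
  end.

Lemma regionRE (a b : R) : regionR (a, b) = normal_ratio (Complex a b).
Proof.
rewrite /regionR /normal_ratio normc_def -complexIm ler0c /=.
set n := _ + _; have n0 : 0 <= n by rewrite addr_ge0 ?sqr_ge0.
rewrite (_ : 0 = 0%:C%C :> R[i]) // (_ : 1 = 1%:C%C :> R[i]) //.
rewrite !ltcR sqrtr_gt0 (inj_eq (@complexI R)).
congr (_ && _ || _ && _).
  by rewrite -[X in _ = (_ < X)]sqrtr1 ltr_sqrt ?ltr01.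
by rewrite -[X in _ = (_ == X)]sqrtr1 eqr_sqrt ?ler01.
Qed.

Lemma model_params_inj : injective model_params.
Proof.
have n10 : (1 == 0 :> R[i]) = false by rewrite oner_eq0.
have n01 : (0 == 1 :> R[i]) = false by rewrite eq_sym.
move=> [||||p] [||||q] // /eqP; rewrite !xpair_eqE ?n10 ?n01 ?andbF //= ?eqxx ?andbT.
rewrite eq_complex /= => /andP[/eqP e1 /eqP e2]; congr Sab_J.
apply/val_inj; rewrite /= [val p]surjective_pairing e1 e2.
by rewrite -surjective_pairing.
Qed.

Lemma admissible_model c p l d : admissible c p l d ->
  exists m, model_params m = (c, p, l, d).
Proof.
case=> [||||[a b] n].
- by exists (AffC_R2_J R).
- by exists (S1_J1 R).
- by exists (S1_J2 R).
- by exists (S2_J R).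
have n' : regionR (a, b) by rewrite regionRE.
by exists (Sab_J (exist _ (a, b) n')).
Qed.

Lemma model_admissible m :
  let: (c, p, l, d) := model_params m in admissible c p l d.
Proof. by case: m => [||||[[a b] /= n]]; constructor; rewrite -regionRE. Qed.

(** * Normal frames of the models *)

Section TableFrames.
Variables (ct : nat -> nat -> 'rV[R]_6) (w p a b : R).
Variable jac : jacobi_identity (table_bracket ct).
Hypothesis cE : Defs.gen_table w p a b ct.
Local Notation g := (table_lie jac : lieAlgType R).

Section Frame.
Variables (J : 'End(g)) (J2 : forall v, J (J v) = - v).
Implicit Types (u v : cplx J2) (z t s : R[i]).

Lemma co_table_bracket u v k : (k < 6)%N ->
  co (cplx_bracket u v) k = Defs.gen_bracket w p a b u v k.
Proof. exact: cE. Qed.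

Lemma co_cplx_scale z v k :
  co (z *: v) k = complex.Re z * co v k + complex.Im z * co (J v) k.
Proof. by rewrite cplx_scaleE Defs.coD !Defs.coZ. Qed.

Lemma co_cplxD u v k : co (u + v) k = co u k + co v k.
Proof. exact: Defs.coD. Qed.

Local Notation f := (base R 0 : cplx J2).
Local Notation x := (base R 2 : cplx J2).
Local Notation y := (base R 4 : cplx J2).

(* [e = 0, h = 1] for the standard complex structure and [e = 1, h = -1] for
   the twisted one. *)
Variables e h : R.
Hypothesis hh : h * h = 1.
Hypothesis comb : forall z t s k, (k < 6)%N -> co (z *: f + t *: x + s *: y) k =
  nth 0 [:: complex.Re z; complex.Im z; complex.Re t; complex.Im t;
            complex.Re s - e * complex.Im t; h * complex.Im s] k.

Lemma table_planeP v : plane x y v <-> co v 0 = 0 /\ co v 1 = 0.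
Proof.
split=> [[z [t ->]]|[v0 v1]].
  by rewrite -[z *: x]add0r -(scale0r f) !comb.
exists (Complex (co v 2) (co v 3)), (Complex (co v 4 + e * co v 3) (h * co v 5)).
apply: Defs.row6P => k k6; rewrite -[_ *: x]add0r -(scale0r f) comb //.
by case: k k6 => [|[|[|[|[|[|k]]]]]] //= _; ring: hh.
Qed.

Lemma table_frame : frame (@cplx_bracket _ _ _ J2) f x y.
Proof.
split.
- move=> v; exists (Complex (co v 0) (co v 1)), (Complex (co v 2) (co v 3)).
  exists (Complex (co v 4 + e * co v 3) (h * co v 5)).
  apply: Defs.row6P => k k6; rewrite comb //.
  by case: k k6 => [|[|[|[|[|[|k]]]]]] //= _; ring: hh.
- move=> [z0 z1] [t0 t1] [s0 s1] e0.
  have c k : (k < 6)%N -> nth 0 [:: z0; z1; t0; t1; s0 - e * t1; h * s1] k = 0.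
    move=> k6.
    have /= <- := @comb (Complex z0 z1) (Complex t0 t1) (Complex s0 s1) k k6.
    by rewrite e0 Defs.co0.
  have h0 : h != 0.
    apply/eqP=> h0; move: hh; rewrite h0 mul0r => /eqP.
    by rewrite eq_sym oner_eq0.
  have /= -> := c 0 isT; have /= -> := c 1 isT; have /= -> := c 2 isT.
  have /= t1E := c 3 isT; have /= s0E := c 4 isT; have /= /eqP := c 5 isT.
  rewrite mulf_eq0 (negPf h0) /= => /eqP->.
  by move: s0E; rewrite t1E mulr0 subr0 => ->.
- by move=> u v; apply/table_planeP; rewrite !co_table_bracket.
- move=> u v /table_planeP[u0 u1] /table_planeP[v0 v1].
  apply: Defs.row6P => k k6; rewrite co_table_bracket // Defs.co0.
  rewrite /Defs.gen_bracket u0 u1 v0 v1.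
  by case: k k6 => [|[|[|[|[|[|k]]]]]] //= _; ring.
Qed.

Lemma table_ad z t s k : (k < 6)%N ->
  co (cplx_bracket f (z *: f + t *: x + s *: y)) k =
  let v4 := complex.Re s - e * complex.Im t in let v5 := h * complex.Im s in
  nth 0 [:: 0; 0; complex.Re t + p * v4; complex.Im t + p * v5;
            w * complex.Im z + a * v4 - b * v5; b * v4 + a * v5] k.
Proof.
have cf i : (i < 6)%N -> co f i = (i == 0)%:R by apply: Defs.co_base.
move=> k6; rewrite co_table_bracket //.
by case: k k6 => [|[|[|[|[|[|k]]]]]] //= _; rewrite !cf // !comb //=; ring.
Qed.

Lemma table_adE z t s z' t' s' :
  (forall k, (k < 6)%N ->
    let v4 := complex.Re s - e * complex.Im t in let v5 := h * complex.Im s in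
    nth 0 [:: 0; 0; complex.Re t + p * v4; complex.Im t + p * v5;
              w * complex.Im z + a * v4 - b * v5; b * v4 + a * v5] k =
    nth 0 [:: complex.Re z'; complex.Im z'; complex.Re t'; complex.Im t';
              complex.Re s' - e * complex.Im t'; h * complex.Im s'] k) ->
  cplx_bracket f (z *: f + t *: x + s *: y) = z' *: f + t' *: x + s' *: y.
Proof.
by move=> E; apply: Defs.row6P => k k6; rewrite table_ad // comb //; apply: E.
Qed.

End Frame.

Section StandardFrame.
Let J : 'End(g) := table_end (J_std_table R).
Hypothesis J2 : forall v, J (J v) = - v.
Local Notation f := (base R 0 : cplx J2).
Local Notation x := (base R 2 : cplx J2).
Local Notation y := (base R 4 : cplx J2).

Lemma std_comb (z t s : R[i]) k : (k < 6)%N ->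
  co (z *: f + t *: x + s *: y) k =
  nth 0 [:: complex.Re z; complex.Im z; complex.Re t; complex.Im t;
            complex.Re s - 0 * complex.Im t; 1 * complex.Im s] k.
Proof.
move=> k6; rewrite !co_cplxD !co_cplx_scale !Defs.co_table_end.
rewrite !Defs.co_base //= !(Defs.coN, Defs.co_base) //=.
by case: k k6 => [|[|[|[|[|[|k]]]]]] //= _; ring.
Qed.

Lemma std_normal_frame :
  normal_frame (@cplx_bracket _ _ _ J2) 0 p%:C%C (Complex a b) w%:C%C f x y.
Proof.
(* Each equation of a normal frame is an instance of [nf]: first the three coefficients of the
   argument of ad [f], then those of the value. *)
have nf (z t s z' t' s' : R[i]) := table_adE std_comb (z := z) (t := t) (s := s)
    (z' := z') (t' := t') (s' := s').
split; first exact: (table_frame (mulr1 1) std_comb).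
- have := nf 0 1 0 0 1 0; rewrite !(scale0r, scale1r, add0r, addr0); apply.
  by case=> [|[|[|[|[|[|k]]]]]] //= _; ring.
- have := nf 0 'i 0 0 'i 0; rewrite !(scale0r, scale1r, add0r, addr0); apply.
  by rewrite -complexiE; case=> [|[|[|[|[|[|k]]]]]] //= _; ring.
- have := nf 0 0 1 0 p%:C%C (Complex a b).
  rewrite !(scale0r, scale1r, add0r, addr0); apply.
  by case=> [|[|[|[|[|[|k]]]]]] //= _; ring.
- have := nf 0 0 'i 0 ('i * p%:C%C) ('i * Complex a b).
  rewrite !(scale0r, scale1r, add0r, addr0) scalerDr !scalerA; apply.
  by rewrite -complexiE; case=> [|[|[|[|[|[|k]]]]]] //= _; ring.
- have := nf 'i 0 0 0 0 w%:C%C; rewrite !(scale0r, scale1r, add0r, addr0); apply.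
  by rewrite -complexiE; case=> [|[|[|[|[|[|k]]]]]] //= _; ring.
Qed.

End StandardFrame.

Section TwistedFrame.
Let J : 'End(g) := table_end (J_twisted_table R).
Hypothesis J2 : forall v, J (J v) = - v.
Hypotheses (p0 : p = 0) (a0 : a = 0) (b0 : b = 0).
Local Notation f := (base R 0 : cplx J2).
Local Notation x := (base R 2 : cplx J2).
Local Notation y := (base R 4 : cplx J2).

Lemma twisted_comb (z t s : R[i]) k : (k < 6)%N ->
  co (z *: f + t *: x + s *: y) k =
  nth 0 [:: complex.Re z; complex.Im z; complex.Re t; complex.Im t;
            complex.Re s - 1 * complex.Im t; -1 * complex.Im s] k.
Proof.
move=> k6; rewrite !co_cplxD !co_cplx_scale !Defs.co_table_end.
rewrite !Defs.co_base //= !(Defs.coD, Defs.coN, Defs.co_base) //=.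
by case: k k6 => [|[|[|[|[|[|k]]]]]] //= _; ring.
Qed.

Lemma twisted_normal_frame :
  normal_frame (@cplx_bracket _ _ _ J2) 1 0 0 w%:C%C f x y.
Proof.
have nf (z t s z' t' s' : R[i]) := table_adE twisted_comb (z := z) (t := t) (s := s)
    (z' := z') (t' := t') (s' := s').
rewrite p0 a0 b0 in nf.
have hh : -1 * -1 = 1 :> R by rewrite mulrNN mulr1.
split; first exact: (table_frame hh twisted_comb).
- have := nf 0 1 0 0 1 0; rewrite !(scale0r, scale1r, add0r, addr0); apply.
  by case=> [|[|[|[|[|[|k]]]]]] //= _; ring.
(* J e1 = e2 - e3, while its bracket with f1 is e2 = J e1 + e3; this is the defect [c = 1]. *)
- have := nf 0 'i 0 0 'i 1; rewrite !(scale0r, scale1r, add0r, addr0); apply.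
  by rewrite -complexiE; case=> [|[|[|[|[|[|k]]]]]] //= _; ring.
- have := nf 0 0 1 0 0 0; rewrite !(scale0r, scale1r, add0r, addr0); apply.
  by case=> [|[|[|[|[|[|k]]]]]] //= _; ring.
- have := nf 0 0 'i 0 0 0; rewrite !(scale0r, scaler0, scale1r, add0r, addr0); apply.
  by rewrite -complexiE; case=> [|[|[|[|[|[|k]]]]]] //= _; ring.
- have := nf 'i 0 0 0 0 w%:C%C; rewrite !(scale0r, scale1r, add0r, addr0); apply.
  by rewrite -complexiE; case=> [|[|[|[|[|[|k]]]]]] //= _; ring.
Qed.

End TwistedFrame.

End TableFrames.

Lemma model_normal_frame (m : model R)
    (J2 : forall v, model_J m (model_J m v) = - v) :
  let: (c, p, l, d) := model_params m in
  exists f x y, normal_frame (@cplx_bracket _ _ _ J2) c p l d f x y.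
Proof.
case: m J2 => [||||[[a b] n]] J2; exists (base R 0), (base R 2), (base R 4).
- exact: (twisted_normal_frame (@Defs.affC_R2_gen R) J2).
- exact: (twisted_normal_frame (@Defs.s1_gen R) J2).
- exact: (std_normal_frame (@Defs.s1_gen R) J2).
- exact: (std_normal_frame (@Defs.s2_gen R) J2).
- exact: (std_normal_frame (@Defs.sab_gen R a b) J2).
Qed.

(** Normal frames are transported by isomorphisms, and two algebras having frames with the same
    parameters are isomorphic. *)
Lemma model_isoP (g : lieAlgType R) (J : 'End(g)) (J2 : forall v, J (J v) = - v)
    (Jab : forall u v, [lie J u, J v] = [lie u, v]) (m : model R) :
  holomorphically_isomorphic J (model_J m) <->
  let: (c, p, l, d) := model_params m in
  exists f x y, normal_frame (@cplx_bracket _ _ _ J2) c p l d f x y.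
Proof.
have [J2' Jab'] := model_abelian_complex_structure m.
have := model_normal_frame J2'.
case: (model_params m) => [[[c p] l] d] [f' [x' [y' N']]].
split=> [|[f [x [y N]]]]; last first.
  apply/(holomorphically_isomorphicP J2 J2').
  by apply: (normal_frame_iso _ _ N N'); apply: cplx_acs_bracket.
move/(holomorphically_isomorphicP J2 J2') => [S [linS [T ST TS] mS]].
exists (T f'), (T x'), (T y').
apply: (normal_frame_image _ _ _ N').
- by move=> k u v; apply: (can_inj ST); rewrite linS !TS.
- by exists S.
- by move=> u v; apply: (can_inj ST); rewrite mS !TS.
Qed.

End Models.

(** * Complex lines and the ideal s' + J s' *)

Section ComplexLines.
Variables (R : realType) (g : lieAlgType R) (J : 'End(g)).
Hypothesis J2 : forall v, J (J v) = - v.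
Implicit Types (W : {vspace g}) (f v : g).

Definition J_stable W := forall v, v \in W -> J v \in W.

Definition add_complex_line W f : {vspace g} := (W + <[f]> + <[J f]>)%VS.

Lemma dim_add_line W f : f \notin W -> \dim (W + <[f]>) = (\dim W).+1.
Proof.
move=> Wf; have f0 : f != 0 by apply: contraNneq Wf => ->; apply: mem0v.
rewrite dimv_disjoint_sum ?dim_vline ?f0 ?addn1 //; apply/eqP.
rewrite -subv0; apply/subvP=> v /memv_capP[Wv /vlineP[k e]].
have [k0|k0] := eqVneq k 0; first by rewrite e k0 scale0r mem0v.
by case/negP: Wf; rewrite -[f](scalerK k0) -e memvZ.
Qed.

(** If [J f = w + r *: f], applying [J] gives [(1 + r * r) *: f = - (J w + r *: w)], and [1 + r * r]
    is nonzero, so [f] would lie in [W]. *)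
Lemma J_notin W f : J_stable W -> f \notin W -> J f \notin (W + <[f]>)%VS.
Proof.
move=> JW Wf; apply/memv_addP=> -[w Ww [_ /vlineP[r ->] e]].
have r0 : 1 + r * r != 0 :> R by rewrite gt_eqF // ltr_pwDl // -expr2 sqr_ge0.
case/negP: Wf; have <- : - (1 + r * r)^-1 *: (J w + r *: w) = f.
  have : (1 + r * r) *: f = - (J w + r *: w).
    have := J2 f; rewrite {1}e (linearD J) (linearZZ J) /= e => e2.
    rewrite scalerDl scale1r -[X in X + _]opprK -e2 scalerDr scalerA.
    by rewrite addrA opprD addrNK.
  by rewrite scaleNr -scalerN => <-; rewrite scalerK.
by rewrite memvZ // memvD ?memvZ ?JW.
Qed.

Lemma dim_add_complex_line W f : J_stable W -> f \notin W ->
  \dim (add_complex_line W f) = (\dim W).+2.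
Proof. by move=> JW Wf; rewrite !dim_add_line // J_notin. Qed.

Lemma add_complex_lineP W f v :
  reflect (exists2 w, w \in W & exists z : R[i], v = w + (z *: (f : cplx J2) : g))
    (v \in add_complex_line W f).
Proof.
apply: (iffP idP) => [|[w Ww [z ->]]].
  case/memv_addP=> _ /memv_addP[w Ww [_ /vlineP[a ->] ->]] [_ /vlineP[b ->] ->].
  by exists w => //; exists (Complex a b); rewrite cplx_scaleE /= addrA.
rewrite cplx_scaleE addrA.
by apply: memv_add; [apply: memv_add|] => //; apply/memvZ/memv_line.
Qed.

Lemma J_stable_scale W (z : R[i]) (v : cplx J2) : J_stable W -> (v : g) \in W ->
  (z *: v : g) \in W.
Proof. by move=> JW Wv; rewrite cplx_scaleE memvD ?memvZ ?JW. Qed.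

Lemma J_stable_add W f : J_stable W -> J_stable (add_complex_line W f).
Proof.
move=> JW v /add_complex_lineP[w Ww [z ->]]; apply/add_complex_lineP.
exists (J w); first exact: JW.
by exists ('i * z); rewrite linearD -scalerA cplx_scale_i.
Qed.

Lemma add_complex_line_sub (U W : {vspace g}) f : J_stable U -> (W <= U)%VS ->
  f \in U -> (add_complex_line W f <= U)%VS.
Proof. by move=> JU sWU Uf; rewrite !subv_add sWU -!memvE Uf JU. Qed.

Lemma J_stable0 : J_stable 0%VS.
Proof. by move=> v; rewrite memv0 => /eqP->; rewrite linear0 mem0v. Qed.

Lemma proper_vector (U W : {vspace g}) : (\dim W < \dim U)%N ->
  exists2 v, v \in U & v \notin W.
Proof.
move=> lt; have /subvPn[v Uv Wv] : ~~ (U <= W)%VS.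
  by apply: contraL lt => /dimvS; rewrite -leqNgt.
by exists v.
Qed.

Lemma complex_line_free W f v (a : R[i]) : J_stable W -> f \notin W -> v \in W ->
  (a *: (f : cplx J2) + v : g) = 0 -> a = 0.
Proof.
move=> JW Wf Wv e; apply/eqP; apply: contraNT Wf => a0.
have -> : f = (a^-1 *: (- v : cplx J2) : g).
  move/eqP: e; rewrite addr_eq0 => /eqP <-.
  by rewrite scalerA mulVf // scale1r.
by apply: J_stable_scale => //; rewrite memvN.
Qed.

End ComplexLines.

Section FrameOfHypotheses.
Variables (R : realType) (s : lieAlgType R) (J : 'End(s)).
Hypothesis J2 : forall v, J (J v) = - v.
Hypothesis dim6 : \dim (fullv : {vspace s}) = 6%N.
Hypothesis dim4 : \dim (derived_J J) = 4%N.
Hypothesis derived_abelian : forall u v, u \in derived_J J -> v \in derived_J J ->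
  [lie u, v] = 0.

Lemma lie_derived (u v : s) : [lie u, v] \in derived_J J.
Proof.
rewrite /derived_J -[X in X \in _]addr0 memv_add ?mem0v //.
have /lie_prodP := subvv (derived_algebra s); apply; exact: memvf.
Qed.

Lemma derived_J_stable : J_stable J (derived_J J).
Proof.
move=> _ /memv_addP[u Uu [_ /memv_imgP[v Uv ->] ->]].
by rewrite linearD /= J2 addrC memv_add ?memvN // memv_img.
Qed.

Lemma derived_J_sub (W : {vspace s}) : J_stable J W ->
  (forall u v : s, [lie u, v] \in W) -> (derived_J J <= W)%VS.
Proof.
move=> JW sub; have sW : (derived_algebra s <= W)%VS by apply/lie_prodP=> u v _ _.
rewrite subv_add sW; apply/subvP=> _ /memv_imgP[v Uv ->].
exact/JW/(subvP sW).
Qed.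

(** Real dimensions 0, 2, 4, 6 leave room to choose [x], then [y], in s' + J s' and [f] outside it,
    each outside the complex span of the preceding space; equality of dimensions shows that the
    choices span. *)
Lemma derived_frame : exists f x y, frame (@cplx_bracket _ _ _ J2) f x y.
Proof.
pose U := derived_J J; have JU : J_stable J U := derived_J_stable.
have st0 := J_stable0 J.
have [x Ux x0] : exists2 x, x \in U & x \notin (0%VS : {vspace s}).
  by apply: proper_vector; rewrite dimv0 dim4.
pose W1 := add_complex_line J 0%VS x.
have st1 : J_stable J W1 := J_stable_add J2 st0.
have dim1 : \dim W1 = 2%N by rewrite dim_add_complex_line // dimv0.
have [y Uy y1] : exists2 y, y \in U & y \notin W1.
  by apply: proper_vector; rewrite dim1 dim4.
pose W2 := add_complex_line J W1 y.
have WU : W2 = U.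
  apply/eqP; rewrite eqEdim dim_add_complex_line // dim1 dim4 leqnn andbT.
  by rewrite !add_complex_line_sub // sub0v.
have [f _ fU] : exists2 f, f \in (fullv : {vspace s}) & f \notin U.
  by apply: proper_vector; rewrite dim6 dim4.
have full v : v \in add_complex_line J U f.
  suff -> : add_complex_line J U f = fullv by apply: memvf.
  by apply/eqP; rewrite eqEdim subvf dim_add_complex_line // dim4 dim6.
have line0 v : v \in W1 -> exists t : R[i], v = (t *: (x : cplx J2) : s).
  move=> /(add_complex_lineP J2)[w]; rewrite memv0 => /eqP-> [t ->].
  by exists t; rewrite add0r.
have plU v : v \in U -> plane (x : cplx J2) y v.
  rewrite -WU => /(add_complex_lineP J2)[_ /line0[t ->] [z ->]].
  by exists t, z.
have Upl v : plane (x : cplx J2) y v -> (v : s) \in U.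
  by move=> [t [z ->]]; apply: memvD; apply: J_stable_scale.
exists f, x, y; split.
- move=> v; have /(add_complex_lineP J2)[w /plU[t [z ->]] [a ->]] := full v.
  by exists a, t, z; rewrite -[RHS]addrA [RHS]addrC.
- move=> a b c e.
  have Ubc : (b *: (x : cplx J2) + c *: (y : cplx J2) : s) \in U.
    by apply: Upl; exists b, c.
  have a0 : a = 0.
    by apply: (complex_line_free JU fU Ubc); rewrite -[RHS]e addrA.
  rewrite a0 scale0r add0r in e.
  have W1x : (b *: (x : cplx J2) : s) \in W1.
    apply/(add_complex_lineP J2); exists 0; rewrite ?mem0v //.
    by exists b; rewrite add0r.
  have c0 : c = 0.
    by apply: (complex_line_free st1 y1 W1x); rewrite addrC.
  rewrite c0 scale0r addr0 in e; split=> //.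
  by apply: (complex_line_free st0 x0 (mem0v _)); rewrite addr0.
- by move=> u v; apply/plU/lie_derived.
- by move=> u v /Upl Uu /Upl Uv; apply: derived_abelian.
Qed.

Lemma derived_not_complex_line (x : cplx J2) :
  ~ forall v w, exists k, @cplx_bracket _ _ _ J2 v w = k *: x.
Proof.
move=> lin; have st0 := J_stable0 J.
pose W := (<[x : s]> + <[J x]>)%VS.
have WE : W = add_complex_line J 0%VS (x : s) by rewrite /add_complex_line add0v.
have st : J_stable J W by rewrite WE; apply: J_stable_add.
have : (derived_J J <= W)%VS.
  apply: derived_J_sub => // u v; have [k e] := lin u v.
  rewrite WE; apply/(add_complex_lineP J2); exists 0; rewrite ?mem0v //.
  by exists k; rewrite add0r -e.
move/dimvS; rewrite dim4 leqNgt => /negP[].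
apply: leq_ltn_trans (dimv_add_leqif _ _) _.
by rewrite !dim_vline; case: (_ == _); case: (_ == _).
Qed.

Lemma nilpotent_of_brackets :
  (forall v1 v2 v3 v4 : s, [lie v1, [lie v2, [lie v3, v4]]] = 0) -> nilpotent s.
Proof.
(* The series starts at index 0 with the whole algebra, so its term 3 is spanned by three nested
   brackets. Writing ad as a linear map turns vanishing into inclusion in a kernel, to which
   [lie_prodP] applies level by level. *)
move=> nil; exists 3; apply/eqP; rewrite -subv0 /=.
pose ad (u : s) : 'End(s) := linfun (HB.pack_for {linear s -> s} (bracket u)
  (GRing.isLinear.Build R s s *:%R (bracket u) (bracket_linearr u))).
have adE u v : ad u v = [lie u, v] by rewrite lfunE.
apply/lie_prodP=> v1 w _; rewrite memv0 -adE -memv_ker; apply: subvP w.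
apply/lie_prodP=> v2 w _; rewrite memv_ker adE -adE -adE -comp_lfunE -memv_ker.
apply: subvP w; apply/lie_prodP=> v3 v4 _ _.
by rewrite memv_ker comp_lfunE /= !adE nil.
Qed.

End FrameOfHypotheses.

(** * The classification: reduction to normal frames and comparison of parameters *)

Theorem theorem4p4 (R : realType) (s : lieAlgType R) (J : 'End(s)) :
  \dim (fullv : {vspace s}) = 6%N ->
  ~ nilpotent s ->
  abelian_complex_structure J ->
  subspace_lie_isomorphic (derived_J J) (abelian_lie R 4) ->
  exists! m : model R, holomorphically_isomorphic J (model_J m).
Proof.
move=> dim6 nnil [J2 Jab] [al [al0 alim almor]].
have dim4 : \dim (derived_J J) = 4%N.
  by rewrite -alim limg_dim_eq ?al0 ?capv0 // dimvf.
have ab u v : u \in derived_J J -> v \in derived_J J -> [lie u, v] = 0.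
  rewrite -alim => /memv_imgP[x _ ->] /memv_imgP[y _ ->].
  rewrite -almor [X in al X](_ : _ = 0) ?linear0 //.
  by apply: big1 => i _; apply: big1 => j _; rewrite scaler0.
have Hbr := cplx_acs_bracket J2 Jab.
have [f0 [x0 [y0 F]]] := derived_frame J2 dim6 dim4 ab.
have [|c [p [l [d [f [x [y [adm N]]]]]]]] := normal_frame_exists Hbr _
    (@derived_not_complex_line _ _ _ J2 dim4) F.
  by move=> nil; apply/nnil/nilpotent_of_brackets.
have [m mE] := admissible_model adm.
exists m; split.
  by apply/(model_isoP J2 Jab); rewrite mE; exists f, x, y.
(* A second model provides another normal frame of the same algebra, so the parameters agree, and
   they determine the model. *)
move=> m' /(model_isoP J2 Jab) H.
apply: model_params_inj; rewrite mE.
move: H (model_admissible m').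
case: (model_params m') => [[[c' p'] l'] d'] [f' [x' [y' N']]] adm'.
by have [-> -> -> ->] := normal_frame_unique Hbr adm adm' N N'.
Qed.
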